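(* Consider a $K$-armed Gaussian bandit in which the rewards of arm $k\in[K]$ are i.i.d. $N(\mu_k,1)$, with arm $1$ optimal ($\mu_1=\max_{k}\mu_k$) and $\Delta_k=\mu_1-\mu_k$. Run the \texttt{ReBoot} algorithm with Gaussian bootstrap weights and exploration aid unit $\sigma_a>1.5$. Then for every horizon $T\ge 2$ the regret satisfies $$R(T)\le \sum_{k=2}^{K}\Delta_k\Big[6+\big\{C_1(\sigma_a)+C_2(\sigma_a)\Delta_k^{-2}\big\}\log T\Big],$$ where $$C_1(\sigma_a)=8(2\sigma_a^2-1)^{-1},\qquad C_2(\sigma_a)=128\sigma_a^2\Big(3.1+2\big(1-2.25\,\sigma_a^{-2}\big)^{-1/2}\Big).$$
   Context: \texttt{ReBoot} algorithm with Gaussian weights and exploration aid unit $\sigma_a>0$: in rounds $t=1,\dots,K$ arm $t$ is pulled once. In each round $t>K$, for each arm $k$, let $Y_{k,1},\dots,Y_{k,s}$ be the $s\ge1$ rewards observed so far from arm $k$, $\bar Y_{k,s}=s^{-1}\sum_{i=1}^s Y_{k,i}$, residuals $e_{k,i}=Y_{k,i}-\bar Y_{k,s}$ for $i\le s$, and pseudo residuals $e_{k,s+1}=\sqrt{s+2}\,\sigma_a$, $e_{k,s+2}=-\sqrt{s+2}\,\sigma_a$. Draw fresh weights $w_1,\dots,w_{s+2}$ i.i.d. $N(0,1)$, independent of everything else, and set the index $\hat\mu^*_{k}=\bar Y_{k,s}+\frac{1}{s+2}\sum_{i=1}^{s+2}w_ie_{k,i}$. Pull $I_t=\arg\max_k\hat\mu^*_k$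 and observe its reward. The regret is $R(T)=T\mu_1-E[\sum_{t=1}^T r_t]=\sum_{k=2}^K\Delta_k E[\sum_{t=1}^T \mathbf 1\{I_t=k\}]$, where $r_t$ is the reward at round $t$. *)

(* Defs.v *)
From HB Require Import structures.
From mathcomp Require Import all_boot all_order all_algebra.
From mathcomp Require Import all_classical all_reals all_analysis.
Set Implicit Arguments. Unset Strict Implicit. Unset Printing Implicit Defensive.
Import Order.TTheory GRing.Theory Num.Theory.
Import numFieldNormedType.Exports.
Local Open Scope classical_set_scope.
Local Open Scope ring_scope.

Definition mutually_independent {R : realType} {d : measure_display}
  {Omega : measurableType d} (P : probability Omega R) {I : eqType}
  (X : I -> Omega -> R) : Prop :=
  forall (J : seq I) (B : I -> set R), uniq J ->
    (forall i, measurable (B i)) ->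
    P (\big[setI/setT]_(i <- J) (X i @^-1` B i)) =
    (\prod_(i <- J) P (X i @^-1` B i))%E.

(* X has law N(m, s^2) (s = standard deviation) *)
Definition has_normal_law {R : realType} {d : measure_display}
  {Omega : measurableType d} (P : probability Omega R)
  (X : Omega -> R) (m s : R) : Prop :=
  forall B : set R, measurable B -> P (X @^-1` B) = normal_prob m s B.

(* The ReBoot algorithm, as a deterministic function of a realization of    *)
(*   y k j : the (j+1)-th reward observed from arm k (reward table model),  *)
(*   w t k i : the (i+1)-th Gaussian bootstrap weight drawn for arm k in    *)
(*             round t+1 (rounds are 0-indexed here: round t+1 <-> t).      *)
(* Arms are 'I_K; k0 is a default arm (used for the argmax definition).     *)
Section ReBoot.
Variables (R : realType) (K : nat) (k0 : 'I_K) (sa : R).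
Variables (y : 'I_K -> nat -> R) (w : nat -> 'I_K -> nat -> R).

Definition reboot_index (t : nat) (k : 'I_K) (s : nat) : R :=
  let ybar := (\sum_(i < s) y k i) / s%:R in
  let e := fun i : nat =>
    if (i < s)%N then y k i - ybar
    else if i == s then Num.sqrt (s.+2)%:R * sa
    else - (Num.sqrt (s.+2)%:R * sa) in
  ybar + (s.+2)%:R^-1 * \sum_(i < s.+2) w t k i * e i.

Definition reboot_arm (t : nat) (n : 'I_K -> nat) : 'I_K :=
  if (t < K)%N then insubd k0 t
  else Order.arg_max k0 xpredT (fun k => reboot_index t k (n k)).

Fixpoint reboot_counts (t : nat) : 'I_K -> nat :=
  match t with
  | 0 => fun _ => 0%N
  | t'.+1 => let n := reboot_counts t' in
             let a := reboot_arm t' n in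
             fun k => (n k + (k == a))%N
  end.

End ReBoot.

Definition reboot_regret {R : realType} {d : measure_display}
  {Omega : measurableType d} (P : probability Omega R) (K : nat) (k0 : 'I_K)
  (mu : 'I_K -> R) (sa : R)
  (Y : 'I_K -> nat -> Omega -> R) (W : nat -> 'I_K -> nat -> Omega -> R)
  (T : nat) : \bar R :=
  (\sum_(k < K) ((mu k0 - mu k)%:E *
     \int[P]_(om in setT)
        ((reboot_counts k0 sa (fun k j => Y k j om) (fun t k i => W t k i om)
           T k)%:R)%:E))%E.

Definition C1 {R : realType} (sa : R) : R := 8 / (2 * sa ^+ 2 - 1).
Definition C2 {R : realType} (sa : R) : R :=
  128 * sa ^+ 2 * (31 / 10 + 2 / Num.sqrt (1 - (225 / 100) / sa ^+ 2)).

(* Main.v *)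
(* Fix a suboptimal arm [k] with gap [D], and put [dl = min (D/2) (4 sa^2)] and
   [tau = mu_1 - dl].  When [k] is pulled after the initial rounds, either its
   own index is at least [tau], or every index is below [tau].

   Overestimation.  The index after [s] pulls has a Gaussian exponential moment
   given the rewards, and a Gaussian-quadratic one over the rewards, so it
   exceeds [mu_k + dl] with probability at most [exp (- c (s+2))] where
   [c = dl^2 / (12 sa^2)].  Past [L ~ ln T / c] pulls this sums, even over all
   [T] rounds, to [1/c].

   Underestimation.  Given the rewards and all weights but those of arm 1 at the
   present round, the event "all the other indices are below [tau]" is fixed; if
   the index of arm 1 is at least [tau], then arm 1 is pulled.  The probability
   of a bad round is therefore at most the expected number of pulls of arm 1,
   weighted by the odds [(1 - Q) / Q] with [Q] the conditional probability that
   its index reaches [tau].  Each number [s] of pulls of arm 1 is left at most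
   once, so summing over the rounds leaves [\sum_s E (odds_s)].  The two pseudo
   residuals alone give [1/Q <= 32 exp (N z^2 / (3 sa^2))], where [N = s+2] and
   [z] is the shortfall of the sample mean; this is integrable over the rewards
   because [sa > 3/2].

   Conditioning is expressed by decoupling: functions of two disjoint
   subfamilies of an independent family are integrated on two copies of the
   sample space. *)

Require Import Defs.
From HB Require Import structures.
From mathcomp Require Import all_boot all_order all_algebra.
From mathcomp Require Import all_classical all_reals all_analysis measurable_realfun.
From mathcomp Require Import lra ring.
Import Order.TTheory GRing.Theory Num.Theory.
Import numFieldNormedType.Exports.
Local Open Scope classical_set_scope.
Local Open Scope ring_scope.

(** * Independent families *)

Section Independence.
Context {R : realType} {d : measure_display} {Omega : measurableType d}.
Variables (P : probability Omega R) (I : eqType) (X : I -> Omega -> R).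
Hypothesis mX : forall i, measurable_fun setT (X i).
Hypothesis indX : mutually_independent P X.

(** A pi-system generating the sigma-algebra of the variables indexed by [J]. The list is
    duplicate-free so that independence applies to it as it stands. *)
Definition cylinder (J : pred I) : set (set Omega) :=
  [set A | exists s B, [/\ uniq s, all J s, (forall i, measurable (B i)) &
     A = \big[setI/setT]_(i <- s) (X i @^-1` B i)]].

(** The points of [Omega] with the coarser sigma-algebra generated by the [X i], [i] in [J].
    Depending only on these variables thus becomes plain measurability on a type. *)
Definition sub_space (J : pred I) : measurableType (sigma_display (cylinder J)) :=
  @g_sigma_algebraType (Omega : pointedType) (cylinder J).

Lemma in_bigsetI (s : seq I) (B : I -> set R) (om : Omega) :
  (\big[setI/setT]_(i <- s) (X i @^-1` B i)) om <->
  forall i, i \in s -> B i (X i om).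
Proof.
elim: s => [|i s ih]; first by rewrite big_nil; split.
rewrite big_cons; split.
  by move=> [Bi /ih Bs] j; rewrite inE => /predU1P[->//|]; exact: Bs.
move=> h; split; first by apply: h; rewrite mem_head.
by apply/ih => j js; apply: h; rewrite inE js orbT.
Qed.

Lemma preimage_cylinder (J : pred I) i (B : set R) :
  J i -> measurable B -> cylinder J (X i @^-1` B).
Proof.
move=> Ji mB; exists [:: i], (fun=> B); split => //=; first by rewrite Ji.
by rewrite big_seq1.
Qed.

Lemma cylinder_setT (J : pred I) : cylinder J setT.
Proof. by exists [::], (fun=> setT); split => //; rewrite big_nil. Qed.

Lemma measurable_cylinder (J : pred I) : cylinder J `<=` measurable.
Proof.
move=> _ [s [B [_ _ mB ->]]]; apply: big_ind => //; first exact: measurableI.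
by move=> i _; rewrite -[X in measurable X]setTI; exact: mX.
Qed.

Lemma cylinder_setI (J : pred I) : setI_closed (cylinder J).
Proof.
move=> _ _ [s [B [us sJ mB ->]]] [s' [B' [us' sJ' mB' ->]]].
exists (undup (s ++ s')), (fun i => (if i \in s then B i else setT) `&`
  (if i \in s' then B' i else setT)); split.
- exact: undup_uniq.
- apply/allP => i; rewrite mem_undup mem_cat => /orP[]; exact: allP.
- by move=> i; apply: measurableI; case: ifP.
apply/seteqP; split => om.
  move=> [/in_bigsetI h /in_bigsetI h']; apply/in_bigsetI => i _.
  by split; case: ifP => // ?; [exact: h|exact: h'].
move/in_bigsetI => h; split; apply/in_bigsetI => i is_.
  by have [] := h i; [rewrite mem_undup mem_cat is_|rewrite is_].
by have [] := h i; [rewrite mem_undup mem_cat is_ orbT|rewrite is_].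
Qed.

Lemma indep_cylinder (J1 J2 : pred I) A B : (forall i, J1 i -> ~~ J2 i) ->
  cylinder J1 A -> cylinder J2 B -> P (A `&` B) = (P A * P B)%E.
Proof.
move=> dJ [s [C [us sJ mC ->]]] [s' [C' [us' sJ' mC' ->]]].
have dss i : i \in s' -> i \notin s.
  by move=> /(allP sJ') J2i; apply: contraL J2i => /(allP sJ); exact: dJ.
(* The two lists share no index, so a single family [D] describes both cylinders and independence
   applies to the concatenated list. *)
pose D i := if i \in s then C i else C' i.
have Es : \big[setI/setT]_(i <- s) (X i @^-1` C i) =
    \big[setI/setT]_(i <- s) (X i @^-1` D i).
  by apply: eq_big_seq => i is_; rewrite /D is_.
have Es' : \big[setI/setT]_(i <- s') (X i @^-1` C' i) =
    \big[setI/setT]_(i <- s') (X i @^-1` D i).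
  by apply: eq_big_seq => i /dss/negbTE is_; rewrite /D is_.
have mD i : measurable (D i) by rewrite /D; case: ifP.
rewrite Es Es' -big_cat/= !indX// ?big_cat//.
rewrite cat_uniq us us' andbT/=.
by apply/hasPn.
Qed.

Lemma sigma_cylinder_measurable (J : pred I) A :
  <<s cylinder J >> A -> measurable A.
Proof.
apply: smallest_sub; first exact: sigma_algebra_measurable.
exact: measurable_cylinder.
Qed.

(** Both sides are finite measures in [A] that agree on the pi-system [G], hence on the
    sigma-algebra it generates. *)
Lemma indep_extend (G : set (set Omega)) (B : set Omega) :
  G `<=` measurable -> setI_closed G -> G setT -> measurable B ->
  (forall A, G A -> P (A `&` B) = (P A * P B)%E) ->
  forall A, <<s G >> A -> P (A `&` B) = (P A * P B)%E.
Proof.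
move=> Gm GI GT mB GB A GA.
have p0 : 0 <= fine (P B) by rewrite fine_ge0.
have pE : P B = (fine (P B))%:E by rewrite fineK// fin_num_measure.
have GTT : \bigcup_(k in [set: nat]) [set: Omega] = setT by rewrite bigcup_const.
have BT : (mrestr P mB setT < +oo)%E by rewrite /mrestr setTI pE ltry.
have e : forall C, G C -> mrestr P mB C = mscale (NngNum p0) P C.
  by move=> C GC; rewrite /mrestr GB// /mscale/= muleC {1}pE.
have : mrestr P mB A = mscale (NngNum p0) P A.
  exact: (@g_sigma_algebra_measure_unique _ _ _ G Gm (fun=> setT) (fun=> GT) GTT
    (mrestr P mB) (mscale (NngNum p0) P) GI e (fun=> BT) A GA).
by rewrite /mrestr => ->; rewrite /mscale/= muleC [in RHS]pE.
Qed.

(** The extension is used twice: first to reduce [A] to a cylinder, then, with the roles exchanged,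
    to reduce [B]. *)
Lemma indep_sigma_cylinder (J1 J2 : pred I) A B : (forall i, J1 i -> ~~ J2 i) ->
  <<s cylinder J1 >> A -> <<s cylinder J2 >> B -> P (A `&` B) = (P A * P B)%E.
Proof.
move=> dJ sA sB; have mB := sigma_cylinder_measurable _ _ sB.
apply: (indep_extend (cylinder J1)) => //.
- exact: measurable_cylinder.
- exact: cylinder_setI.
- exact: cylinder_setT.
move=> {sA} {}A JA; rewrite setIC muleC.
apply: (indep_extend (cylinder J2)) => //.
- exact: measurable_cylinder.
- exact: cylinder_setI.
- exact: cylinder_setT.
- exact: (measurable_cylinder J1).
by move=> C JC; rewrite setIC muleC; exact: indep_cylinder JA JC.
Qed.

Definition sub_id (J : pred I) (om : Omega) : sub_space J := om.

Lemma measurable_sub_id (J : pred I) : measurable_fun setT (sub_id J).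
Proof. by move=> _ B mB; rewrite setTI; exact: sigma_cylinder_measurable mB. Qed.

Lemma measurable_sub_space (J : pred I) i : J i ->
  measurable_fun setT (X i : sub_space J -> R).
Proof.
move=> Ji _ B mB; rewrite setTI; apply: sub_sigma_algebra.
exact: preimage_cylinder.
Qed.

(** The pair of identity maps into the two coarser spaces pushes [P] to a measure that factors on
    rectangles, hence to the product of the marginals; Tonelli gives the iterated integral. This is
    the substitute for conditioning: [om1] is frozen while [om2] is averaged. *)
Theorem decoupling (J1 J2 : pred I) (f : sub_space J1 * sub_space J2 -> \bar R) :
  (forall i, J1 i -> ~~ J2 i) ->
  measurable_fun setT f -> (forall z, 0 <= f z)%E ->
  (\int[P]_om f (om, om) = \int[P]_om1 \int[P]_om2 f (om1, om2))%E.
Proof.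
move=> dJ mf f0.
pose i1 : {mfun Omega >-> sub_space J1} := HB.pack (sub_id J1)
  (isMeasurableFun.Build _ _ _ _ _ (measurable_sub_id J1)).
pose i2 : {mfun Omega >-> sub_space J2} := HB.pack (sub_id J2)
  (isMeasurableFun.Build _ _ _ _ _ (measurable_sub_id J2)).
pose P1 := distribution P i1; pose P2 := distribution P i2.
have mdiag : measurable_fun setT (fun om : Omega => (sub_id J1 om, sub_id J2 om)).
  by apply/measurable_fun_pair; exact: measurable_sub_id.
pose diag : {mfun Omega >-> (sub_space J1 * sub_space J2)%type} :=
  HB.pack (fun om : Omega => (sub_id J1 om, sub_id J2 om))
  (isMeasurableFun.Build _ _ _ _ _ mdiag).
transitivity (\int[distribution P diag]_z f z)%E.
  by rewrite ge0_integral_distribution.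
transitivity (\int[P1 \x P2]_z f z)%E.
  apply: eq_measure_integral => A mA _; apply/esym.
  apply: product_measure_unique => // C D mC mD.
  exact: (indep_sigma_cylinder J1 J2).
rewrite fubini_tonelli1// ge0_integral_distribution//.
- apply: eq_integral => om _ /=.
  by rewrite /fubini_F ge0_integral_distribution//; exact: measurableT_comp.
- exact: measurable_fun_fubini_tonelli_F.
- by move=> x; apply: integral_ge0.
Qed.

Lemma measurable_partial_integral (J1 J2 : pred I)
    (f : sub_space J1 * sub_space J2 -> \bar R) :
  measurable_fun setT f -> (forall z, 0 <= f z)%E ->
  measurable_fun setT (fun om1 : Omega => (\int[P]_om2 f (om1, om2))%E).
Proof.
move=> mf f0.
pose i2 : {mfun Omega >-> sub_space J2} := HB.pack (sub_id J2)
  (isMeasurableFun.Build _ _ _ _ _ (measurable_sub_id J2)).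
have mF := measurable_fun_fubini_tonelli_F (m2 := distribution P i2) f mf f0.
rewrite (_ : (fun _ => _) = fubini_F (distribution P i2) f \o sub_id J1).
  exact: (measurableT_comp mF (measurable_sub_id J1)).
apply/funext => om /=.
by rewrite /fubini_F ge0_integral_distribution//; exact: measurableT_comp.
Qed.

(** Induction on the list, decoupling the first factor from the product of the others. *)
Lemma expectation_prod (s : seq I) (f : I -> R -> R) : uniq s ->
  (forall i, measurable_fun setT (f i)) -> (forall i x, 0 <= f i x) ->
  (\int[P]_om (\prod_(i <- s) f i (X i om))%:E =
   \prod_(i <- s) \int[P]_om (f i (X i om))%:E)%E.
Proof.
move=> + mf f0; elim: s => [_|i s ih /= /andP[is_ us]].
  under eq_integral do rewrite big_nil.
  by rewrite big_nil integral_cst// mul1e; exact: probability_setT.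
under eq_integral do rewrite big_cons.
rewrite big_cons.
have mfX (J : pred I) j : J j ->
    measurable_fun setT (fun om : sub_space J => f j (X j om)).
  by move=> Jj; apply: measurableT_comp => //; exact: measurable_sub_space.
have mfP (J : pred I) (r : seq I) : all J r ->
    measurable_fun setT (fun om : sub_space J => \prod_(j <- r) f j (X j om)).
  move=> /allP Jr; rewrite (_ : (fun _ => _) =
    (fun om : sub_space J => \prod_(j <- r) (if J j then f j (X j om) else 1))).
    apply: measurable_prod => j jr; case: (boolP (J j)) => [Jj|_]; first exact: mfX.
    exact: measurable_cst.
  apply/funext => om; apply: eq_big_seq => j jr.
  by rewrite Jr.
pose F (z : sub_space (pred1 i) * sub_space (mem s)) :=
  (f i (X i z.1) * \prod_(j <- s) f j (X j z.2))%:E.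
have mF : measurable_fun setT F.
  apply/measurable_EFinP; apply: measurable_funM.
    exact: (measurableT_comp (mfX (pred1 i) i (eqxx i)) measurable_fst).
  have sP : all (mem s) s by exact/allP.
  exact: (measurableT_comp (mfP (mem s) s sP) measurable_snd).
have F0 z : (0 <= F z)%E by rewrite lee_fin mulr_ge0// prodr_ge0.
have := decoupling (pred1 i) (mem s) F _ mF F0.
rewrite /F/= => -> => [|j /eqP ->]; last exact: is_.
have mpr : measurable_fun setT (fun om : Omega => \prod_(j <- s) f j (X j om)).
  by apply: measurable_prod => j _; exact: measurableT_comp.
under eq_integral => om _.
  under eq_integral do rewrite EFinM.
  rewrite ge0_integralZl ?lee_fin//; last 2 first.
  - exact/measurable_EFinP.
  - by move=> x _; rewrite lee_fin prodr_ge0.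
  over.
rewrite ge0_integralZr//=.
- by rewrite ih.
- by apply/measurable_EFinP; exact: measurableT_comp.
- by move=> x _; rewrite lee_fin.
- by apply: integral_ge0 => x _; rewrite lee_fin prodr_ge0.
Qed.

End Independence.

(** * Normal integrals *)

Section NormalLaw.
Context {R : realType}.
Local Notation leb := (@lebesgue_measure R).

(** The Radon-Nikodym derivative of the normal law equals the Gaussian density almost everywhere,
    because the two have the same integral over every measurable set. *)
Lemma ge0_integral_normal_prob (m s : R) (f : R -> \bar R) :
  measurable_fun setT f -> (forall x, 0 <= f x)%E ->
  (\int[normal_prob m s]_x f x = \int[leb]_x (f x * (normal_pdf m s x)%:E))%E.
Proof.
move=> mf f0; have dom := normal_prob_dominates m s.
pose g := Radon_Nikodym_SigmaFinite.f (normal_prob m s) leb.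
have mg : measurable_fun setT g.
  exact: measurable_int (Radon_Nikodym_SigmaFinite.f_integrable dom).
have mpdf : measurable_fun setT (fun x => (normal_pdf m s x)%:E).
  by apply/measurable_EFinP; exact: measurable_normal_pdf.
rewrite -(Radon_Nikodym_SigmaFinite.change_of_variables dom)//.
apply: ae_eq_integral => //; [exact: emeasurable_funM|exact: emeasurable_funM|].
apply: ae_eqe_mul2l; apply: integral_ae_eq => //.
  exact: Radon_Nikodym_SigmaFinite.f_integrable dom.
by move=> E _ mE; rewrite -Radon_Nikodym_SigmaFinite.f_integral.
Qed.

(** The reflection [F x = 2 m - x] exchanges the two rays and preserves the density. *)
Lemma integral_ray_normal_pdf (m s : R) : s != 0 ->
  (\int[leb]_(x in `]-oo, m]) (normal_pdf m s x)%:E =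
   \int[leb]_(x in `[m, +oo[) (normal_pdf m s x)%:E)%E.
Proof.
move=> s0; pose F (x : R) := m + m - x.
have Fm : F m = m by rewrite /F addrK.
have F' : F^`()%classic = cst (-1).
  by apply/funext => x; rewrite derive1E deriveB// derive_id derive_cst sub0r.
have cF : continuous F.
  move=> x; apply: (@cvgB _ R^o) => //; exact: cvg_cst.
have c := @continuous_normal_pdf _ m _ s0.
have := @decreasing_ge0_integration_by_substitutiony R F (normal_pdf m s) m.
rewrite Fm => ->; first 1 last.
- by move=> x y _ _ xy; rewrite /F ltrD2l ltrN2.
- by rewrite F' => ? _; exact: cvg_cst.
- by rewrite F'; exact: is_cvg_cst.
- by rewrite F'; exact: is_cvg_cst.
- split; last exact: cvg_at_right_filter (cF m).
  by move=> x _; apply: derivableB.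
- apply/cvgNry; rewrite (_ : - F = fun x => x + - (m + m)); first exact: cvg_addrr.
  by apply/funext => x; rewrite /F !fctE opprB.
- by apply: continuous_subspaceT => x; exact: c.
- by move=> x _; exact: normal_pdf_ge0.
apply: eq_integral => x _; rewrite F' /= !fctE opprK mulr1.
by rewrite !normal_pdfE// /normal_fun; do 3 congr (_ _); rewrite /F; ring.
Qed.

(** The two rays have equal mass and cover the line. *)
Lemma normal_prob_ray (m s : R) : s != 0 ->
  (2^-1%:E <= normal_prob m s `[m, +oo[)%E /\
  (2^-1%:E <= normal_prob m s `]-oo, m])%E.
Proof.
move=> s0.
have e : normal_prob m s `]-oo, m] = normal_prob m s `[m, +oo[.
  exact: integral_ray_normal_pdf.
have h : (1 <= normal_prob m s `]-oo, m] + normal_prob m s `[m, +oo[)%E.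
  rewrite -(probability_setT (normal_prob m s)).
  apply: le_trans (measureU2 _ _ _) => //.
  apply: le_measure; rewrite ?inE//; first exact: measurableU.
  by move=> x _ /=; rewrite !in_itv/= andbT; case: (leP x m); [left|right; exact: ltW].
suff : (2^-1%:E <= normal_prob m s `[m, +oo[)%E by rewrite e.
move: h; rewrite e.
have : normal_prob m s `[m, +oo[ \is a fin_num by rewrite fin_num_measure.
move=> /fineK <-; rewrite -EFinD !lee_fin; lra.
Qed.

End NormalLaw.

(** * Moments, tails and symmetry of the standard normal law *)

Section StandardNormal.
Context {R : realType}.

Lemma normal_peakE (s : R) : 0 < s -> normal_peak s = s^-1 * normal_peak 1.
Proof.
move=> s0; rewrite /normal_peak expr1n mul1r -mulrnAr sqrtrM ?sqr_ge0//.
by rewrite sqrtr_sqr gtr0_norm// invfM.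
Qed.

Lemma normal_pdf1E (m x : R) :
  normal_pdf m 1 x = normal_peak 1 * expR (- (x - m) ^+ 2 / 2).
Proof. by rewrite normal_pdfE ?oner_neq0// /normal_fun expr1n. Qed.

(** Completing the square: with [v = 1 - 2 b > 0], the integrand times the density is the constant
    [C] times the density of the normal law of mean [m + a / v] and variance [1 / v]. *)
Lemma integral_normal_quadratic (m a b : R) : b < 2^-1 ->
  (\int[normal_prob m 1]_x (expR (a * (x - m) + b * (x - m) ^+ 2))%:E =
   ((Num.sqrt (1 - 2 * b))^-1 * expR (a ^+ 2 / (2 * (1 - 2 * b))))%:E)%E.
Proof.
move=> b2; set v := 1 - 2 * b; set C := (_ * expR _).
have v0 : 0 < v by rewrite /v; lra.
pose s := (Num.sqrt v)^-1.
have s0 : 0 < s by rewrite invr_gt0 sqrtr_gt0.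
have s2 : s ^+ 2 = v^-1 by rewrite /s exprVn sqr_sqrtr// ltW.
have mf : measurable_fun [set: R]
    (fun x : R => expR (a * (x - m) + b * (x - m) ^+ 2)).
  apply: measurableT_comp => //; apply: measurable_funD.
    by apply: measurable_funM => //; exact: measurable_funB.
  apply: measurable_funM => //; apply: measurable_funX; exact: measurable_funB.
rewrite ge0_integral_normal_prob; last 2 first.
- exact/measurable_EFinP.
- by move=> x; rewrite lee_fin expR_ge0.
transitivity (\int[@lebesgue_measure R]_x
    (C%:E * (normal_pdf (m + a / v) s x)%:E))%E; last first.
  rewrite ge0_integralZl//=.
  - by rewrite integral_normal_pdf mule1.
  - by apply/measurable_EFinP; exact: measurable_normal_pdf.
  - by move=> x _; rewrite lee_fin normal_pdf_ge0.
  - by rewrite lee_fin /C mulr_ge0 ?expR_ge0// invr_ge0 sqrtr_ge0.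
apply: eq_integral => x _; rewrite -!EFinM; congr EFin.
rewrite normal_pdf1E normal_pdfE ?gt_eqF// (normal_peakE _ s0) /normal_fun s2.
rewrite /C -/s mulrCA -expRD.
rewrite [RHS](_ : _ = (s * s^-1) * normal_peak 1 * (expR (a ^+ 2 / (2 * v)) *
   expR (- (x - (m + a / v)) ^+ 2 / (v^-1 *+ 2)))); last by ring.
rewrite divff ?gt_eqF// mul1r -expRD; congr (_ * expR _).
rewrite -mulr_natr /v; field.
by rewrite -/v gt_eqF.
Qed.

(* [-x^2/2 = -2(x-u)^2 - 2u^2/3 + (3/2)(x - 4u/3)^2], so the standard density
   dominates a multiple of the one of N(u, 1/4), half of which lies above [u]. *)
Lemma normal_pdf_ge (u x : R) :
  2^-1 * expR (- (2 / 3 * u ^+ 2)) * normal_pdf u 2^-1 x <= normal_pdf 0 1 x.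
Proof.
have h0 : (0 : R) < 2^-1 by rewrite invr_gt0.
rewrite normal_pdf1E normal_pdfE ?gt_eqF// (normal_peakE _ h0) invrK /normal_fun.
rewrite [leLHS](_ : _ = normal_peak 1 * (expR (- (2 / 3 * u ^+ 2)) *
  expR (- (x - u) ^+ 2 / (2^-1 ^+ 2 *+ 2)))); last by field.
rewrite ler_wpM2l ?normal_peak_ge0// -expRD ler_expR subr0 -subr_ge0.
rewrite [leRHS](_ : _ = 3 / 2 * (x - 4 / 3 * u) ^+ 2); last by field.
by rewrite mulr_ge0// sqr_ge0.
Qed.

Lemma normal_prob_ge (u : R) (A : set R) : measurable A ->
  ((2^-1 * expR (- (2 / 3 * u ^+ 2)))%:E * normal_prob u 2^-1 A
   <= normal_prob 0 1 A)%E.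
Proof.
move=> mA; have mp m s : measurable_fun A (normal_pdf m s : R -> R).
  exact: measurable_funTS (measurable_normal_pdf _ _).
rewrite /normal_prob -ge0_integralZl//=.
- apply: ge0_le_integral => //=.
  + by move=> x _; rewrite -EFinM lee_fin mulr_ge0 ?normal_pdf_ge0// mulr_ge0 ?expR_ge0.
  + apply/measurable_EFinP; apply: measurable_funM => //.
    exact: mp.
  + by apply/measurable_EFinP; exact: mp.
  + by move=> x _; rewrite -EFinM lee_fin normal_pdf_ge.
- by apply/measurable_EFinP; exact: mp.
- by move=> x _; rewrite lee_fin normal_pdf_ge0.
Qed.

(** The comparison law N(u, 1/4) puts at least half of its mass on each side of [u], whatever the
    sign of [u]; one factor 1/2 comes from this and one from the comparison. *)
Lemma normal_prob_tail (u : R) :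
  ((4^-1 * expR (- (2 / 3 * u ^+ 2)))%:E <= normal_prob 0 1 `[u, +oo[)%E /\
  ((4^-1 * expR (- (2 / 3 * u ^+ 2)))%:E <= normal_prob 0 1 `]-oo, u])%E.
Proof.
have h2 : (2^-1 : R) != 0 by rewrite gt_eqF.
have [h1 h2'] := @normal_prob_ray R u 2^-1 h2.
have c0 : (0 <= (2^-1 * expR (- (2 / 3 * u ^+ 2)))%:E :> \bar R)%E.
  by rewrite lee_fin mulr_ge0 ?expR_ge0.
have E : (4^-1 * expR (- (2 / 3 * u ^+ 2)))%:E =
    ((2^-1 * expR (- (2 / 3 * u ^+ 2)))%:E * 2^-1%:E)%E.
  by rewrite -EFinM; congr EFin; field.
by split; rewrite E; apply: le_trans (normal_prob_ge u _ _) => //; exact: lee_wpmul2l.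
Qed.

(** The law and its reflection agree on the rays [[x, +oo[], a pi-system generating the Borel
    sets. *)
Lemma normal_prob_opp (B : set R) : measurable B ->
  normal_prob (0 : R) 1 (-%R @^-1` B) = normal_prob (0 : R) 1 B.
Proof.
move=> mB.
have mopp : @measurable_fun _ _ (measurableTypeR R) (measurableTypeR R) [set: R]
  (-%R : R -> R) by exact: measurable_funN.
pose o : {mfun measurableTypeR R >-> measurableTypeR R} := HB.pack (-%R : R -> R)
  (isMeasurableFun.Build _ _ _ _ _ mopp).
have := @measure_unique _ R (measurableTypeR R) (@RGenCInfty.G R)
  (fun n => `[(- n%:R : R), +oo[%classic).
move=> /(_ _ _ _ _ (distribution (normal_prob (0 : R) 1) o) (normal_prob (0 : R) 1)).
move=> u; apply: u => //.
- exact: RGenCInfty.measurableE.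
- move=> _ _ [x ->] [y ->]; exists (Num.max x y).
  apply/seteqP; split => z /=; rewrite !in_itv/= !andbT ge_max.
    by move=> [-> ->].
  by move=> /andP[].
- by move=> n; exists (- n%:R).
- rewrite -subTset => x _; exists (Num.truncn `|x|).+1 => //=.
  rewrite in_itv/= andbT lerNl (le_trans (ler_norm _))// normrN.
  by rewrite ltW// truncnS_gt.
- move=> _ [x ->]; rewrite /distribution /pushforward /=.
  rewrite (_ : -%R @^-1` _ = `]-oo, - x]%classic); last first.
    by apply/seteqP; split => z /=; rewrite !in_itv/= andbT lerNr.
  rewrite /normal_prob ge0_integration_by_substitutionNy//.
  + apply: eq_integral => z _ /=.
    by rewrite !normal_pdf1E !subr0 sqrrN.
  + apply: continuous_subspaceT => z; apply: continuous_normal_pdf.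
    exact: oner_neq0.
  + by move=> z _; exact: normal_pdf_ge0.
- move=> n; rewrite -ge0_fin_numE//; apply: fin_num_measure.
  by rewrite /= ; exact: measurable_itv.
Qed.

End StandardNormal.

(** * Linear combinations of independent normals *)

Lemma integral_indicT {R : realType} d (T : measurableType d)
    (mu : {measure set T -> \bar R}) (A : set T) : measurable A ->
  (\int[mu]_x (\1_A x)%:E = mu A)%E.
Proof. by move=> mA; rewrite integral_indic// setIT. Qed.

Section IndependentNormals.
Context {R : realType} {d : measure_display} {Omega : measurableType d}.
Variable P : probability Omega R.

Lemma ge0_integral_normal_law (Z : Omega -> R) (m s : R) (f : R -> \bar R) :
  measurable_fun setT Z -> has_normal_law P Z m s ->
  measurable_fun setT f -> (forall x, 0 <= f x)%E ->
  (\int[P]_om f (Z om) = \int[normal_prob m s]_x f x)%E.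
Proof.
move=> mZ lZ mf f0.
have mZ' : @measurable_fun _ _ Omega (measurableTypeR R) setT Z by exact: mZ.
pose Z' : {mfun Omega >-> measurableTypeR R} := HB.pack Z
  (isMeasurableFun.Build _ _ _ _ _ mZ').
transitivity (\int[distribution P Z']_x f x)%E.
  by rewrite ge0_integral_distribution.
by apply: eq_measure_integral => A mA _; exact: lZ.
Qed.

Variables (I : eqType) (X : I -> Omega -> R).
Hypothesis mX : forall i, measurable_fun setT (X i).
Hypothesis indX : mutually_independent P X.

Lemma measurable_quadratic (a b m : R) :
  measurable_fun [set: R] (fun x : R => a * (x - m) + b * (x - m) ^+ 2).
Proof.
apply: measurable_funD.
  by apply: measurable_funM => //; exact: measurable_funB.
by apply: measurable_funM => //; apply: measurable_funX; exact: measurable_funB.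
Qed.

Lemma expectation_exp_quadratic (s : seq I) (m a b : I -> R) : uniq s ->
  (forall i, i \in s -> has_normal_law P (X i) (m i) 1) ->
  (forall i, b i < 2^-1) ->
  (\int[P]_om (expR (\sum_(i <- s)
      (a i * (X i om - m i) + b i * (X i om - m i) ^+ 2)))%:E =
   (\prod_(i <- s) ((Num.sqrt (1 - 2 * b i))^-1 *
      expR (a i ^+ 2 / (2 * (1 - 2 * b i)))))%:E)%E.
Proof.
move=> us lX b2.
pose f i (x : R) := expR (a i * (x - m i) + b i * (x - m i) ^+ 2).
have mf i : measurable_fun setT (f i).
  by apply: measurableT_comp => //; exact: measurable_quadratic.
have f0 i x : 0 <= f i x by rewrite expR_ge0.
under eq_integral do rewrite expR_sum.
rewrite (expectation_prod _ _ _ mX indX s f us mf f0).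
rewrite -prodEFin; apply: eq_big_seq => i is_.
rewrite (ge0_integral_normal_law _ _ _ (fun x => (f i x)%:E) (mX i) (lX i is_)).
- by rewrite /f integral_normal_quadratic.
- exact/measurable_EFinP.
- by move=> x; rewrite lee_fin.
Qed.

Lemma measurable_lincomb (s : seq I) (c : I -> R) :
  measurable_fun setT (fun om => \sum_(i <- s) c i * X i om).
Proof. by apply: measurable_sum => i; exact: measurable_funM. Qed.

Lemma expectation_exp_lincomb (s : seq I) (c : I -> R) : uniq s ->
  (forall i, i \in s -> has_normal_law P (X i) 0 1) ->
  (\int[P]_om (expR (\sum_(i <- s) c i * X i om))%:E =
   (expR ((\sum_(i <- s) c i ^+ 2) / 2))%:E)%E.
Proof.
move=> us lX.
have := expectation_exp_quadratic s (fun=> 0) c (fun=> 0) us lX.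
rewrite invr_gt0 ltr0n => /(_ (fun=> isT)).
under eq_integral do under eq_bigr do rewrite subr0 mul0r addr0.
move=> ->; congr EFin.
rewrite mulr_suml expR_sum; apply: eq_bigr => i _.
by rewrite mulr0 subr0 mulr1 sqrtr1 invr1 mul1r.
Qed.

(** Markov's inequality for the exponential of [th] times the sum. *)
Lemma chernoff_lincomb (s : seq I) (c : I -> R) (th t : R) : uniq s ->
  (forall i, i \in s -> has_normal_law P (X i) 0 1) -> 0 < th ->
  (P [set om | (t <= \sum_(i <- s) c i * X i om)%R]
   <= (expR (th ^+ 2 * (\sum_(i <- s) c i ^+ 2) / 2 - th * t))%:E)%E.
Proof.
move=> us lX th0; set S := fun om => \sum_(i <- s) c i * X i om.
have mS : measurable_fun setT S by exact: measurable_lincomb.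
have mE : measurable [set om | t <= S om].
  rewrite (_ : [set _ | _] = S @^-1` `[t, +oo[%classic); last first.
    by apply/seteqP; split => om /=; rewrite in_itv/= andbT.
  by rewrite -[X in measurable X]setTI; exact: mS.
rewrite -integral_indicT//.
apply: (@le_trans _ _ (\int[P]_om ((expR (- (th * t)))%:E *
    (expR (\sum_(i <- s) (th * c i) * X i om))%:E))%E).
  apply: ge0_le_integral => //=.
  - by apply/measurable_EFinP; exact: measurable_indic.
  - apply/measurable_EFinP; apply: measurable_funM => //.
    by apply: measurableT_comp => //; exact: measurable_lincomb.
  - move=> om _; rewrite -EFinM lee_fin -expRD.
    rewrite indicE; case: (boolP (om \in _)) => [|_]; last by rewrite expR_ge0.
    rewrite inE/= => tS; rewrite -expR0 ler_expR.
    under eq_bigr do rewrite -mulrA.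
    by rewrite -mulr_sumr addrC subr_ge0 ler_wpM2l// ltW.
rewrite ge0_integralZl//=.
- rewrite expectation_exp_lincomb// -EFinM lee_fin -expRD ler_expR.
  rewrite addrC lerD2r (eq_bigr (fun i => th ^+ 2 * c i ^+ 2)) => [|i _].
    by rewrite -mulr_sumr.
  by rewrite exprMn.
- apply/measurable_EFinP.
  by apply: measurableT_comp => //; exact: measurable_lincomb.
Qed.

Lemma measurable_lincomb_preimage (s : seq I) (c : I -> R) (B : set R) :
  measurable B ->
  measurable ((fun om => \sum_(i <- s) c i * X i om) @^-1` B).
Proof. by move=> mB; rewrite -[X in measurable X]setTI; exact: measurable_lincomb. Qed.

(** Induction on the list. With the head frozen, the tail is negated by the induction hypothesis;
    with the tail frozen, the head is negated by the symmetry of N(0, 1). *)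
Lemma lincomb_symmetric (s : seq I) (c : I -> R) (B : set R) : uniq s ->
  (forall i, i \in s -> has_normal_law P (X i) 0 1) -> measurable B ->
  P ((fun om => \sum_(i <- s) c i * X i om) @^-1` B) =
  P ((fun om => - \sum_(i <- s) c i * X i om) @^-1` B).
Proof.
elim: s B => [|i s ih] B /=.
  by move=> _ _ _; congr (P _); apply/funext => om /=; rewrite !big_nil oppr0.
move=> /andP[is_ us] lX mB.
have mshift (r : R) : measurable ((fun x => r + x) @^-1` B).
  have m : measurable_fun [set: R] (fun x => r + x) by exact: measurable_funD.
  by rewrite -[X in measurable X]setTI; exact: m.
(* [f] carries the original sum, [g] has the tail negated, [h] is [g] with the two blocks in the
   other order, and [k] has head and tail negated. *)
pose f (z : sub_space I X (pred1 i) * sub_space I X (mem s)) : \bar R :=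
  (\1_B (c i * X i z.1 + \sum_(j <- s) c j * X j z.2))%:E.
pose g (z : sub_space I X (pred1 i) * sub_space I X (mem s)) : \bar R :=
  (\1_B (c i * X i z.1 - \sum_(j <- s) c j * X j z.2))%:E.
pose h (z : sub_space I X (mem s) * sub_space I X (pred1 i)) : \bar R :=
  (\1_B (- \sum_(j <- s) c j * X j z.1 + c i * X i z.2))%:E.
pose k (z : sub_space I X (mem s) * sub_space I X (pred1 i)) : \bar R :=
  (\1_B (- \sum_(j <- s) c j * X j z.1 - c i * X i z.2))%:E.
have mXi : measurable_fun setT (fun om : sub_space I X (pred1 i) => c i * X i om).
  by apply: measurable_funM => //; exact: (measurable_sub_space I X (pred1 i) i (eqxx i)).
have mXs : measurable_fun setT
    (fun om : sub_space I X (mem s) => \sum_(j <- s) c j * X j om).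
  (* The guard changes no summand and makes every one measurable on the coarser space, whatever its
     index. *)
  rewrite (_ : (fun _ => _) = (fun om : sub_space I X (mem s) =>
      \sum_(j <- s) (if j \in s then c j * X j om else 0))).
    apply: measurable_sum => j; case: (boolP (j \in s)) => [js|_]; last exact: measurable_cst.
    by apply: measurable_funM => //; exact: (measurable_sub_space I X (mem s) j js).
  by apply/funext => om; apply: eq_big_seq => j ->.
have m1B : measurable_fun setT (\1_B : R -> R) by exact: measurable_indic.
have mf : measurable_fun setT f.
  apply/measurable_EFinP; apply: (measurableT_comp m1B); apply: measurable_funD.
    exact: (measurableT_comp mXi measurable_fst).
  exact: (measurableT_comp mXs measurable_snd).
have mg : measurable_fun setT g.
  apply/measurable_EFinP; apply: (measurableT_comp m1B); apply: measurable_funB.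
    exact: (measurableT_comp mXi measurable_fst).
  exact: (measurableT_comp mXs measurable_snd).
have mh : measurable_fun setT h.
  apply/measurable_EFinP; apply: (measurableT_comp m1B); apply: measurable_funD.
    by apply: measurable_funN; exact: (measurableT_comp mXs measurable_fst).
  exact: (measurableT_comp mXi measurable_snd).
have mk : measurable_fun setT k.
  apply/measurable_EFinP; apply: (measurableT_comp m1B); apply: measurable_funB.
    by apply: measurable_funN; exact: (measurableT_comp mXs measurable_fst).
  exact: (measurableT_comp mXi measurable_snd).
have dis : forall j, pred1 i j -> ~~ (mem s) j by move=> j /eqP ->.
have dsi : forall j, (mem s) j -> ~~ pred1 i j.
  by move=> j js; apply: contra is_ => /eqP <-.
have PE (u : Omega -> R) : measurable_fun setT u ->
    P (u @^-1` B) = (\int[P]_om (\1_B (u om))%:E)%E.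
  move=> mu; rewrite -integral_indicT//; rewrite -[X in measurable X]setTI.
  exact: mu.
have mL := measurable_lincomb s c.
have mNL : measurable_fun setT (fun om => - \sum_(j <- s) c j * X j om).
  exact: measurable_funN.
have mXi' : measurable_fun setT (fun om => c i * X i om) by exact: measurable_funM.
have lXi := lX i (mem_head _ _).
have lXs : forall j, j \in s -> has_normal_law P (X j) 0 1.
  by move=> j js; apply: lX; rewrite inE js orbT.
under eq_fun do rewrite big_cons.
under [in RHS]eq_fun do rewrite big_cons opprD addrC.
rewrite PE; last exact: measurable_funD.
rewrite PE; last by apply: measurable_funB => //; exact: measurable_funN.
rewrite (decoupling P _ _ mX indX _ _ f dis mf) => [|z]; last by rewrite lee_fin.
rewrite (decoupling P _ _ mX indX _ _ k dsi mk) => [|z]; last by rewrite lee_fin.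
transitivity (\int[P]_om1 \int[P]_om2 g (om1, om2))%E.
  apply: eq_integral => om _; rewrite /f /g/=.
  have := ih _ us lXs (mshift (c i * X i om)).
  rewrite -[in X in X = _ -> _]integral_indicT; last exact: measurable_lincomb_preimage.
  rewrite -[in X in _ = X -> _]integral_indicT//.
  by rewrite -[X in measurable X]setTI; exact: mNL.
rewrite -(decoupling P _ _ mX indX _ _ g dis mg) => [|z]; last by rewrite lee_fin.
transitivity (\int[P]_om1 \int[P]_om2 h (om1, om2))%E.
  rewrite -(decoupling P _ _ mX indX _ _ h dsi mh) => [|z]; last by rewrite lee_fin.
  by apply: eq_integral => om _; rewrite /g /h/= addrC.
apply: eq_integral => om _; rewrite /h /k/=.
set r := - _.
have mC (e : R) : measurable_fun [set: R] (fun x => (\1_B (r + e * x))%:E : \bar R).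
  apply/measurable_EFinP; apply: (measurableT_comp m1B).
  by apply: measurable_funD => //; exact: measurable_funM.
have E0 (e : R) x : (0 <= (\1_B (r + e * x))%:E :> \bar R)%E by rewrite lee_fin.
rewrite (ge0_integral_normal_law _ _ _ _ (mX i) lXi (mC (c i)) (E0 (c i))).
under [RHS]eq_integral do rewrite -mulNr.
rewrite (ge0_integral_normal_law _ _ _ _ (mX i) lXi (mC (- c i)) (E0 (- c i))).
have mopp : @measurable_fun _ _ (measurableTypeR R) (measurableTypeR R) [set: R]
  (-%R : R -> R) by exact: measurable_funN.
pose o : {mfun measurableTypeR R >-> measurableTypeR R} := HB.pack (-%R : R -> R)
  (isMeasurableFun.Build _ _ _ _ _ mopp).
transitivity (\int[distribution (normal_prob (0 : R) 1) o]_x (\1_B (r + c i * x))%:E)%E.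
  by apply: eq_measure_integral => A mA _; apply/esym; exact: (normal_prob_opp A mA).
rewrite ge0_integral_distribution//.
  by apply: eq_integral => x _ /=; rewrite mulrN mulNr.
exact: (mC (c i)).
Qed.

(** By symmetry the sum is nonnegative as often as it is nonpositive, and one of the two always
    holds. *)
Lemma lincomb_ge0_prob (s : seq I) (c : I -> R) : uniq s ->
  (forall i, i \in s -> has_normal_law P (X i) 0 1) ->
  (2^-1%:E <= P [set om | (0 <= \sum_(i <- s) c i * X i om)%R])%E.
Proof.
move=> us lX; set A := [set om | _].
have sym := lincomb_symmetric s c `[0, +oo[%classic us lX.
have h : (1 <= P A + P A)%E.
  rewrite -[leLHS](probability_setT P).
  have EA : A = (fun om => \sum_(i <- s) c i * X i om) @^-1` `[0, +oo[.
    by apply/seteqP; split => om /=; rewrite in_itv/= andbT.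
  have mA : measurable A by rewrite EA; exact: measurable_lincomb_preimage.
  have mA' : measurable
      ((fun om => - \sum_(i <- s) c i * X i om) @^-1` `[0, +oo[%classic).
    have m : measurable_fun setT (fun om => - \sum_(i <- s) c i * X i om).
      by apply: measurable_funN; exact: measurable_lincomb.
    by rewrite -[X in measurable X]setTI; exact: m.
  rewrite {2}EA sym//; apply: le_trans (measureU2 _ _ _) => //.
  apply: le_measure; rewrite ?inE//; first exact: measurableU.
  move=> om _ /=; rewrite in_itv/= andbT oppr_ge0.
  by case: (leP 0 (\sum_(i <- s) c i * X i om)) => [|/ltW]; [left|right].
move: h; have : P A \is a fin_num.
  apply: fin_num_measure.
  rewrite (_ : A = (fun om => \sum_(i <- s) c i * X i om) @^-1` `[0, +oo[%classic).
    exact: measurable_lincomb_preimage.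
  by apply/seteqP; split => om /=; rewrite in_itv/= andbT.
by move=> /fineK <-; rewrite -EFinD !lee_fin; lra.
Qed.

End IndependentNormals.

(** * Rewards *)

Section Numerics.
Context {R : realType}.

(** After squaring, this is [1 + x <= exp x] at [x = 1 / v - 1]. *)
Lemma invr_sqrt_le_expR (v : R) : 0 < v ->
  (Num.sqrt v)^-1 <= expR ((v^-1 - 1) / 2).
Proof.
move=> v0; rewrite -(@ler_pXn2r _ 2)// ?nnegrE ?invr_ge0 ?sqrtr_ge0 ?expR_ge0//.
rewrite exprVn sqr_sqrtr ?(ltW v0)// -expRM_natl mulrC divfK ?pnatr_eq0//.
by have := expR_ge1Dx (v^-1 - 1); rewrite addrC subrK.
Qed.

(* With [th = dl / (6 sg^2) <= 2/3] the Chernoff exponent is at most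
   [N (- th dl + 3 th^2 sg^2) = - N dl^2 / (12 sg^2)]. *)
Lemma chernoff_exponent (s : nat) (sg dl th : R) : (0 < s)%N ->
  9 / 4 <= sg ^+ 2 -> 0 <= th -> th <= 2 / 3 -> dl = 6 * sg ^+ 2 * th ->
  ((Num.sqrt (1 - th ^+ 2))^-1 *
     expR ((th * s.+2%:R / s%:R) ^+ 2 / (2 * (1 - th ^+ 2)))) ^+ s *
  expR (th ^+ 2 * (s.+2%:R * sg ^+ 2) - th * s.+2%:R * dl)
  <= expR (- (3 * sg ^+ 2 * th ^+ 2 * s.+2%:R)).
Proof.
move=> s0 sg2 th0 th1 ->; set N : R := s.+2%:R; set S : R := s%:R.
have S1 : 1 <= S by rewrite ler1n.
have NS : N = S + 2 by rewrite /N /S -addn2 natrD.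
have Nge0 : 0 <= N by exact: ler0n.
have Sge0 : 0 <= S by exact: ler0n.
have th2 : th ^+ 2 <= 4 / 9 by nra.
have th20 : 0 <= th ^+ 2 by rewrite sqr_ge0.
set v := 1 - th ^+ 2; have v0 : 0 < v by rewrite /v; lra.
have vi : v^-1 <= 9 / 5.
  by rewrite -[leRHS]invrK lef_pV2 ?posrE ?invr_gt0//; rewrite ?invf_div /v; lra.
have vi0 : 0 < v^-1 by rewrite invr_gt0.
have vn0 : v != 0 by rewrite gt_eqF.
apply: (@le_trans _ _ ((expR ((v^-1 - 1) / 2) *
    expR ((th * N / S) ^+ 2 / (2 * v))) ^+ s *
  expR (th ^+ 2 * (N * sg ^+ 2) - th * N * (6 * sg ^+ 2 * th)))).
  rewrite ler_wpM2r ?expR_ge0//; apply: lerXn2r; rewrite ?nnegrE.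
  - by rewrite mulr_ge0 ?expR_ge0// invr_ge0 sqrtr_ge0.
  - by rewrite mulr_ge0 ?expR_ge0.
  - by rewrite ler_wpM2r ?expR_ge0// invr_sqrt_le_expR.
rewrite -expRD -expRM_natl -expRD ler_expR -/S.
have e1 : S * ((v^-1 - 1) / 2) = S * th ^+ 2 * v^-1 / 2.
  have -> : v^-1 - 1 = th ^+ 2 * v^-1; last by ring.
  by rewrite -[X in _ - X](divff vn0) /v; ring.
have e2 : S * ((th * N / S) ^+ 2 / (2 * v)) = th ^+ 2 * (N * (N / S)) * v^-1 / 2.
  by field; apply/andP; split; rewrite gt_eqF//; lra.
have NS3 : N / S <= 3 by rewrite ler_pdivrMr ?NS; lra.
have NS0 : 0 <= N / S by rewrite divr_ge0 // ?NS; lra.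
rewrite mulrDr e1 e2.
have a1 : S * th ^+ 2 * v^-1 <= N * th ^+ 2 * (9 / 5).
  apply: ler_pM => //; first exact: mulr_ge0.
    exact: ltW.
  by rewrite ler_wpM2r// NS; lra.
have a2 : th ^+ 2 * (N * (N / S)) * v^-1 <= th ^+ 2 * (N * 3) * (9 / 5).
  apply: ler_pM => //; first by do 2?apply: mulr_ge0.
    exact: ltW.
  by apply: ler_wpM2l => //; apply: ler_wpM2l.
have a3 : 0 <= N * th ^+ 2 * (sg ^+ 2 - 9 / 4).
  by do 2?apply: mulr_ge0 => //; lra.
have N0 : 0 <= N * th ^+ 2 by exact: mulr_ge0.
(* Using [1 / v <= 9/5] and [N / S <= 3], the halves of [A] and [B] are at most 9/10 and 27/10 times
   [N th^2]. It remains that [18/5 - 5 sg^2 <= - 3 sg^2], which follows from [sg^2 >= 9/4]. *)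
move: a1 a2 a3 N0; set A := _ * v^-1; set B := _ * v^-1.
nra.
Qed.

(** From [1 + r <= exp r], each term satisfies [r exp (- r s) <= exp (- r (s-1)) - exp (- r s)], and
    the right sides telescope. *)
Lemma geometric_tail_le (r : R) (T L : nat) : 0 < r ->
  \sum_(s < T | (L < s)%N) expR (- (r * s%:R)) <= expR (- (r * L%:R)) / r.
Proof.
move=> r0; rewrite ler_pdivlMr// mulrC.
(* The induction keeps the last term of the telescoping sum; for [T <= L] the sum is empty and the
   right side vanishes. *)
suff: r * \sum_(s < T | (L < s)%N) expR (- (r * s%:R)) <= expR (- (r * L%:R)) -
    (if (L < T)%N then expR (- (r * T.-1%:R)) else expR (- (r * L%:R))).
  by move=> /le_trans; apply; rewrite gerBl; case: ifP => _; rewrite expR_ge0.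
elim: T => [|T ih]; first by rewrite big_ord0 mulr0 ltn0 subrr.
rewrite big_mkcond big_ord_recr/= -big_mkcond/= mulrDr ltnS.
case: (ltngtP L T) ih => [LT|TL|LT] ih.
- apply: le_trans (lerD ih (lexx _)) _.
  have T1 : T.-1%:R = T%:R - 1 :> R.
    by rewrite -subn1 natrB// (leq_ltn_trans (leq0n L)).
  have : (1 + r) * expR (- (r * T%:R)) <= expR (- (r * T.-1%:R)).
    rewrite T1 [X in _ <= expR X](_ : _ = r + - (r * T%:R)); last by ring.
    by rewrite expRD ler_wpM2r ?expR_ge0// expR_ge1Dx.
  lra.
- by rewrite mulr0 addr0.
- by move: ih; rewrite LT mulr0 addr0.
Qed.

End Numerics.

Definition sample_mean {R : realType} (y : nat -> R) (s : nat) : R :=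
  (\sum_(i < s) y i) / s%:R.

Definition residual_ss {R : realType} (y : nat -> R) (s : nat) : R :=
  \sum_(i < s) (y i - sample_mean y s) ^+ 2.

Lemma sum_iota (R : realType) (F : nat -> R) s :
  \sum_(i <- iota 0 s) F i = \sum_(i < s) F i.
Proof. by rewrite -(big_mkord xpredT F) /index_iota subn0. Qed.

Lemma prod_iota_cst (R : realType) (x : R) s : \prod_(i <- iota 0 s) x = x ^+ s.
Proof. by rewrite big_const_seq count_predT size_iota -Monoid.iteropE. Qed.

(** * Exponential moments of the sample mean and of the residuals *)

Section Rewards.
Context {R : realType} {d : measure_display} {Omega : measurableType d}.
Variables (P : probability Omega R) (y : nat -> Omega -> R) (mu : R).
Hypothesis my : forall j, measurable_fun setT (y j).
Hypothesis ly : forall j, has_normal_law P (y j) mu 1.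
Hypothesis indy : mutually_independent P y.

Let mean s om := sample_mean (fun j => y j om) s.
Let rss s om := residual_ss (fun j => y j om) s.

Lemma measurable_sample_mean s : measurable_fun setT (mean s).
Proof. by apply: measurable_funM => //; apply: measurable_sum => i. Qed.

Lemma measurable_residual_ss s : measurable_fun setT (rss s).
Proof.
apply: measurable_sum => i; apply: measurable_funX; apply: measurable_funB => //.
exact: measurable_sample_mean.
Qed.

Lemma sample_mean_center s om : (0 < s)%N ->
  mean s om - mu = (\sum_(i < s) (y i om - mu)) / s%:R.
Proof.
move=> s0; rewrite /mean /sample_mean sumrB sumr_const card_ord mulrBl.
by rewrite -[mu *+ s]mulr_natr mulfK ?pnatr_eq0 -?lt0n.
Qed.

(** The sum of squares about [mu] exceeds the one about the sample mean by exactly [s] times the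
    squared error of the mean. *)
Lemma residual_ss_le s om : (0 < s)%N ->
  rss s om <= \sum_(i < s) (y i om - mu) ^+ 2.
Proof.
move=> s0; set D := mean s om - mu.
have s0' : s%:R != 0 :> R by rewrite pnatr_eq0 -lt0n.
have sD : \sum_(i < s) (y i om - mu) = s%:R * D.
  by rewrite /D sample_mean_center// mulrCA divff// mulr1.
have -> : rss s om = \sum_(i < s) ((y i om - mu) ^+ 2 - 2 * D * (y i om - mu) + D ^+ 2).
  apply: eq_bigr => i _; rewrite -/(mean s om).
  have -> : mean s om = D + mu by rewrite /D subrK.
  by ring.
rewrite big_split/= sumrB -mulr_sumr sD sumr_const card_ord -[_ *+ s]mulr_natr.
rewrite [leLHS](_ : _ = \sum_(i < s) (y i om - mu) ^+ 2 - s%:R * D ^+ 2); last by ring.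
by rewrite lerBlDr lerDl mulr_ge0// sqr_ge0.
Qed.

Lemma measurable_chernoff_integrand s (c1 c2 c3 c4 : R) :
  measurable_fun setT (fun om =>
    expR (c1 * (rss s om / 2 + c2) + c3 * (mean s om - mu) - c4)).
Proof.
apply: measurableT_comp => //.
apply: measurable_funB => //; apply: measurable_funD.
  apply: measurable_funM => //; apply: measurable_funD => //.
  by apply: measurable_funM => //; exact: measurable_residual_ss.
apply: measurable_funM => //; apply: measurable_funB => //.
exact: measurable_sample_mean.
Qed.

(** The integrand is the Chernoff bound for the bootstrap noise given the rewards. The sign [e] is 1
    for overestimation and -1 for underestimation. Replacing the residual sum of squares by the sum
    of squares about [mu] turns the exponent into a sum over independent rewards. *)
Lemma expectation_chernoff_rewards s (sg dl th e : R) : (0 < s)%N ->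
  9 / 4 <= sg ^+ 2 -> 0 <= th -> th <= 2 / 3 -> dl = 6 * sg ^+ 2 * th ->
  e ^+ 2 = 1 ->
  (\int[P]_om (expR (th ^+ 2 * (rss s om / 2 + s.+2%:R * sg ^+ 2)
      + e * (th * s.+2%:R) * (mean s om - mu) - th * s.+2%:R * dl))%:E
   <= (expR (- (3 * sg ^+ 2 * th ^+ 2 * s.+2%:R)))%:E)%E.
Proof.
move=> s0 sg2 th0 th1 hdl e2.
set N : R := s.+2%:R.
pose C := expR (th ^+ 2 * (N * sg ^+ 2) - th * N * dl).
pose a := e * (th * N) / s%:R; pose b := th ^+ 2 / 2.
have b2 : b < 2^-1.
  by rewrite /b -[ltRHS]mul1r ltr_pM2r ?invr_gt0//; nra.
have mq : measurable_fun setT (fun om => expR (\sum_(i <- iota 0 s)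
    (a * (y i om - mu) + b * (y i om - mu) ^+ 2))).
  apply: measurableT_comp => //; apply: measurable_sum => i.
  exact: (measurableT_comp (measurable_quadratic a b mu) (my i)).
apply: (@le_trans _ _ (\int[P]_om (C%:E * (expR (\sum_(i <- iota 0 s)
    (a * (y i om - mu) + b * (y i om - mu) ^+ 2)))%:E))%E).
  apply: ge0_le_integral => //=.
  - by apply/measurable_EFinP; exact: measurable_chernoff_integrand.
  - by apply/measurable_EFinP; exact: measurable_funM.
  - move=> om _; rewrite -EFinM lee_fin -expRD ler_expR.
    rewrite sum_iota big_split/= -!mulr_sumr.
    have := residual_ss_le s om s0; rewrite sample_mean_center//.
    move=> h; have : b * rss s om <= b * \sum_(i < s) (y i om - mu) ^+ 2.
      by apply: ler_wpM2l => //; rewrite /b mulr_ge0 ?sqr_ge0.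
    rewrite {1}/b /a; set S2 := \sum_(i < s) (_ ^+ 2); set S1 := \sum_(i < s) _.
    move=> {}h; rewrite [leLHS](_ : _ = (th ^+ 2 * (N * sg ^+ 2) - th * N * dl) +
      (e * (th * N) / s%:R * S1 + th ^+ 2 / 2 * rss s om)); last by ring.
    by rewrite lerD2l lerD2l.
have C0 : (0 <= C%:E)%E by rewrite lee_fin expR_ge0.
rewrite ge0_integralZl//=; last by apply/measurable_EFinP.
rewrite (expectation_exp_quadratic P _ _ my indy _ (fun=> mu) (fun=> a) (fun=> b))
  ?iota_uniq// prod_iota_cst -EFinM lee_fin mulrC.
apply: le_trans (chernoff_exponent s sg dl th s0 sg2 th0 th1 hdl).
have -> : a ^+ 2 = (th * s.+2%:R / s%:R) ^+ 2.
  by rewrite /a -mulrA exprMn e2 mul1r.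
have -> : 2 * b = th ^+ 2 by rewrite /b; field.
by [].
Qed.

Lemma expectation_exp_mean s (l dl : R) : (0 < s)%N ->
  (\int[P]_om (expR (l * (mu - mean s om - dl)))%:E =
   (expR (l ^+ 2 / (2 * s%:R) - l * dl))%:E)%E.
Proof.
move=> s0; have s0' : s%:R != 0 :> R by rewrite pnatr_eq0 -lt0n.
pose a := - l / s%:R.
have mq : measurable_fun setT (fun om => expR (\sum_(i <- iota 0 s)
    (a * (y i om - mu) + 0 * (y i om - mu) ^+ 2))).
  apply: measurableT_comp => //; apply: measurable_sum => i.
  exact: (measurableT_comp (measurable_quadratic a 0 mu) (my i)).
transitivity (\int[P]_om ((expR (- (l * dl)))%:E * (expR (\sum_(i <- iota 0 s)
    (a * (y i om - mu) + 0 * (y i om - mu) ^+ 2)))%:E))%E.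
  apply: eq_integral => om _; rewrite -EFinM -expRD; congr (expR _)%:E.
  under eq_bigr do rewrite mul0r addr0.
  rewrite -mulr_sumr sum_iota /a -[mu - mean s om]opprB sample_mean_center//.
  by ring.
rewrite ge0_integralZl//=; last by apply/measurable_EFinP.
rewrite (expectation_exp_quadratic P _ _ my indy _ (fun=> mu) (fun=> a) (fun=> 0))
  ?iota_uniq ?invr_gt0// prod_iota_cst -EFinM mulr0 subr0 sqrtr1 invr1 mul1r.
rewrite -expRM_natl -expRD /a mulr1; congr (expR _)%:E.
by field.
Qed.

(* Writing [exp (b s z^2)] as the mean of [exp (sqrt (2 b s) g z)] over a
   standard normal [g] reduces the left side to an exponential moment. *)
Lemma expectation_exp_mean_sq s (b dl : R) : (0 < s)%N -> 0 <= b -> b < 2^-1 ->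
  (\int[P]_om (expR (b * s%:R * (mu - mean s om - dl) ^+ 2
       + s%:R * dl * (mu - mean s om - dl)))%:E =
   ((Num.sqrt (1 - 2 * b))^-1 * expR (- (s%:R * dl ^+ 2 / 2)))%:E)%E.
Proof.
move=> s0 b0 b2; have s0' : s%:R != 0 :> R by rewrite pnatr_eq0 -lt0n.
pose r := Num.sqrt (2 * b * s%:R).
have r2 : r ^+ 2 = 2 * b * s%:R by rewrite sqr_sqrtr// !mulr_ge0.
pose z om := mu - mean s om - dl.
have mz : measurable_fun setT z.
  apply: measurable_funB => //; apply: measurable_funB => //.
  exact: measurable_sample_mean.
pose f (p : Omega * measurableTypeR R) : \bar R :=
  (expR ((r * p.2 + s%:R * dl) * z p.1))%:E.
have mf : measurable_fun setT f.
  apply/measurable_EFinP; apply: measurableT_comp => //.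
  apply: measurable_funM; last exact: (measurableT_comp mz measurable_fst).
  by apply: measurable_funD => //; apply: measurable_funM => //; exact: measurable_snd.
have f0 p : (0 <= f p)%E by rewrite lee_fin expR_ge0.
transitivity (\int[P]_om \int[normal_prob (0:R) 1]_g f (om, g))%E.
  apply: eq_integral => om _; rewrite /f/=.
  have E0 : (0 : R) < 2^-1 by rewrite invr_gt0.
  have E := @integral_normal_quadratic R 0 (r * z om) 0 E0.
  transitivity (\int[normal_prob (0:R) 1]_g ((expR (s%:R * dl * z om))%:E *
      (expR (r * z om * (g - 0) + 0 * (g - 0) ^+ 2))%:E))%E; last first.
    apply: eq_integral => g _; rewrite -EFinM -expRD; congr (expR _)%:E.
    by ring.
  rewrite ge0_integralZl//=; last first.
    apply/measurable_EFinP.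
    by apply: measurableT_comp => //; exact: (measurable_quadratic (r * z om) 0 0).
  rewrite E -EFinM mulr0 subr0 sqrtr1 invr1 mul1r -expRD exprMn r2.
  by congr (expR _)%:E; rewrite -/(z om); field.
rewrite (fubini_tonelli f mf f0).
(* With [l = r g + s dl] the terms linear in [g] cancel in [l^2 / (2 s) - l dl], leaving
   [b g^2 - s dl^2 / 2]. This is the reason for the weight [s dl] of the linear term. *)
have rE g : (\int[P]_om f (om, g) =
    ((expR (- (s%:R * dl ^+ 2 / 2)))%:E * (expR (0 * (g - 0) + b * (g - 0) ^+ 2))%:E))%E.
  rewrite /f/= expectation_exp_mean// -EFinM -expRD; congr (expR _)%:E.
  rewrite subr0 mul0r add0r.
  rewrite [LHS](_ : _ = (r ^+ 2) * g ^+ 2 / (2 * s%:R) - s%:R * dl ^+ 2 / 2); last by field.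
  by rewrite r2; field.
under eq_integral do rewrite rE.
rewrite ge0_integralZl//=; last first.
  apply/measurable_EFinP.
  by apply: measurableT_comp => //; exact: (measurable_quadratic 0 b 0).
by rewrite integral_normal_quadratic// expr0n/= mul0r expR0 mulr1 -EFinM mulrC.
Qed.

End Rewards.

(** * Bootstrap noise *)

Section Noise.
Context {R : realType} {d : measure_display} {Omega : measurableType d}.
Variables (P : probability Omega R) (w : nat -> Omega -> R).
Hypothesis mw : forall j, measurable_fun setT (w j).
Hypothesis lw : forall j, has_normal_law P (w j) 0 1.
Hypothesis indw : mutually_independent P w.
Variable e : nat -> R.

Let noise n om := \sum_(i < n) w i om * e i.

Lemma noiseE n om : noise n om = \sum_(i <- iota 0 n) e i * w i om.
Proof. by rewrite sum_iota; apply: eq_bigr => i _; rewrite mulrC. Qed.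

Lemma measurable_noise n : measurable_fun setT (noise n).
Proof. by apply: measurable_sum => i; exact: measurable_funM. Qed.

Lemma measurable_noise_ge n t : measurable [set om | t <= noise n om].
Proof.
rewrite (_ : [set _ | _] = noise n @^-1` `[t, +oo[%classic); last first.
  by apply/seteqP; split => om /=; rewrite in_itv/= andbT.
by rewrite -[X in measurable X]setTI; exact: measurable_noise.
Qed.

Lemma noise_ge0_prob n : (2^-1%:E <= P [set om | (0 <= noise n om)%R])%E.
Proof.
have := lincomb_ge0_prob P _ w mw indw (iota 0 n) e (iota_uniq 0 n) (fun i _ => lw i).
by under eq_set do rewrite -noiseE.
Qed.

Lemma noise_chernoff n (th t : R) : 0 < th ->
  (P [set om | (t <= noise n om)%R] <=
   (expR (th ^+ 2 * (\sum_(i < n) e i ^+ 2) / 2 - th * t))%:E)%E.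
Proof.
move=> th0.
have := chernoff_lincomb P _ w mw indw (iota 0 n) e th t (iota_uniq 0 n)
  (fun i _ => lw i) th0.
under eq_set do rewrite -noiseE.
by rewrite (sum_iota _ (fun i => e i ^+ 2)).
Qed.

(** Three independent events force the noise above [t]: the first [s] terms sum to at least 0, the
    weight of the positive pseudo residual is at least [u = t / (2 a)], and that of the negative one
    is at most [- u]. Their probabilities give [32 = 2 * 4 * 4] and [4/3 = 2/3 + 2/3]. *)
Lemma noise_tail s (a t : R) : 0 < a -> e s = a -> e s.+1 = - a ->
  ((32^-1 * expR (- (4 / 3 * (t / (2 * a)) ^+ 2)))%:E <=
   P [set om | (t <= noise s.+2 om)%R])%E.
Proof.
move=> a0 es es1; set u := t / (2 * a).
pose A := [set om | 0 <= noise s om].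
pose B1 := w s @^-1` `[u, +oo[%classic.
pose B2 := w s.+1 @^-1` `]-oo, - u]%classic.
have cB1 : cylinder _ w (pred1 s) B1 by apply: preimage_cylinder => /=.
have cB2 : cylinder _ w (pred1 s.+1) B2 by apply: preimage_cylinder => /=.
pose J := [pred i | (i == s) || (i == s.+1)].
have sB1 : <<s cylinder _ w J >> B1.
  by apply: sub_sigma_algebra; apply: preimage_cylinder => //=; rewrite eqxx.
have sB2 : <<s cylinder _ w J >> B2.
  by apply: sub_sigma_algebra; apply: preimage_cylinder => //=; rewrite eqxx orbT.
have sB : <<s cylinder _ w J >> (B1 `&` B2).
  exact: (@measurableI _ (sub_space _ w J) B1 B2 sB1 sB2).
have sA : <<s cylinder _ w (fun i => i < s)%N >> A.
  have m : measurable_fun setT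
      (fun om : sub_space _ w (fun i => i < s)%N => \sum_(i < s) w i om * e i).
    apply: measurable_sum => i; apply: measurable_funM => //.
    by apply: (measurable_sub_space _ w (fun i => i < s)%N i); exact: ltn_ord.
  rewrite (_ : A = (fun om => \sum_(i < s) w i om * e i) @^-1` `[0, +oo[%classic).
    by rewrite -[X in <<s _ >> X]setTI; exact: m.
  by apply/seteqP; split => om /=; rewrite in_itv/= andbT.
have mB1 : measurable B1 by exact: measurable_cylinder cB1.
have mB2 : measurable B2 by exact: measurable_cylinder cB2.
have mA : measurable A by exact: measurable_noise_ge.
have PB : P (B1 `&` B2) = (P B1 * P B2)%E.
  apply: (indep_cylinder P _ w indw (pred1 s) (pred1 s.+1)) => //.
  by move=> i /eqP ->; rewrite /= neq_ltn ltnSn.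
have PAB : P (A `&` (B1 `&` B2)) = (P A * P (B1 `&` B2))%E.
  apply: (indep_sigma_cylinder P _ w mw indw (fun i => i < s)%N J) => //.
  by move=> i /= is_; rewrite negb_or !neq_ltn is_ (ltn_trans is_).
apply: (@le_trans _ _ (P (A `&` (B1 `&` B2)))).
  rewrite PAB PB.
  have [t1 _] := @normal_prob_tail R u; have [_ t2] := @normal_prob_tail R (- u).
  have e32 : (32^-1 * expR (- (4 / 3 * u ^+ 2)))%:E =
     (2^-1%:E * ((4^-1 * expR (- (2 / 3 * u ^+ 2)))%:E *
      (4^-1 * expR (- (2 / 3 * u ^+ 2)))%:E) : \bar R)%E.
    rewrite -!EFinM; congr EFin.
    rewrite [RHS](_ : _ = 32^-1 * (expR (- (2 / 3 * u ^+ 2)) * expR (- (2 / 3 * u ^+ 2)))).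
      by rewrite -expRD; congr (_ * expR _); field.
    by field.
  have p0 : (0 <= (4^-1 * expR (- (2 / 3 * u ^+ 2)))%:E :> \bar R)%E.
    by rewrite lee_fin mulr_ge0 ?expR_ge0.
  rewrite e32; apply: lee_pmul.
  - by rewrite lee_fin.
  - exact: mule_ge0.
  - exact: noise_ge0_prob.
  apply: lee_pmul => //.
  - by rewrite lw.
  - by rewrite lw//; rewrite sqrrN in t2.
apply: le_measure; rewrite ?inE//.
- by apply: measurableI => //; exact: measurableI.
- exact: measurable_noise_ge.
move=> om /= [A0 []]; rewrite /B1 /B2 /= !in_itv/= andbT => h1 h2.
rewrite /noise !big_ord_recr/= es es1 -/(noise s om).
have tu : t = u * a + u * a.
  by rewrite /u; field; rewrite gt_eqF.
rewrite [in leLHS]tu mulrN -addrA; apply: le_trans (_ : w s om * a - w s.+1 om * a <= _).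
  by apply: lerD; [rewrite ler_pM2r|rewrite -mulNr ler_pM2r// lerNr].
by rewrite lerDr.
Qed.

(** For [t >= 0] the left side is bounded by 1 and the right probability from below by the pseudo
    residuals. For [t < 0] the right probability is at least 1/2, and the left one is bounded by
    Chernoff for the negated noise. *)
Lemma noise_odds s (a th t : R) : 0 < a -> e s = a -> e s.+1 = - a -> 0 < th ->
  (P [set om | (noise s.+2 om < t)%R] <=
   (if (0 <= t)%R then 32 * expR (4 / 3 * (t / (2 * a)) ^+ 2)
    else 2 * expR (th ^+ 2 * (\sum_(i < s.+2) e i ^+ 2) / 2 + th * t))%:E *
   P [set om | (t <= noise s.+2 om)%R])%E.
Proof.
move=> a0 es es1 th0; set G := [set om | (t <= noise s.+2 om)%R].
have Ple1 (E : set Omega) : measurable E -> (P E <= 1)%E.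
  by move=> mE; exact: probability_le1.
have mL : measurable [set om | noise s.+2 om < t].
  rewrite (_ : [set _ | _] = ~` G); first by apply: measurableC; exact: measurable_noise_ge.
  by apply/seteqP; split => om /=; rewrite ltNge => /negP.
case: ifPn => [t0|]; last rewrite -ltNge => t0.
  apply: le_trans (Ple1 _ mL) _.
  have := noise_tail s a t a0 es es1; set x := 4 / 3 * _ => h.
  apply: le_trans (_ : ((32 * expR x)%:E * (32^-1 * expR (- x))%:E <= _)%E).
    rewrite -EFinM lee_fin expRN.
    rewrite [leRHS](_ : _ = expR x / expR x); last by field; rewrite gt_eqF ?expR_gt0.
    by rewrite divff// gt_eqF ?expR_gt0.
  by apply: lee_wpmul2l => //; rewrite lee_fin mulr_ge0 ?expR_ge0.
have G2 : (2^-1%:E <= P G)%E.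
  apply: le_trans (noise_ge0_prob s.+2) _; apply: le_measure; rewrite ?inE.
  - exact: measurable_noise_ge.
  - exact: measurable_noise_ge.
  by move=> om /=; apply: le_trans; exact: ltW.
set X := expR _.
apply: le_trans (_ : (X%:E <= _)%E); last first.
  apply: le_trans (_ : ((2 * X)%:E * 2^-1%:E <= _)%E).
    by rewrite -EFinM lee_fin mulrC mulrA mulVf ?mul1r.
  by apply: lee_wpmul2l => //; rewrite lee_fin mulr_ge0 ?expR_ge0.
have := chernoff_lincomb P _ w mw indw (iota 0 s.+2) (fun i => - e i) th (- t)
  (iota_uniq 0 s.+2) (fun i _ => lw i) th0.
rewrite mulrN opprK (eq_bigr (fun i => e i ^+ 2)); last by move=> i _; rewrite sqrrN.
rewrite (sum_iota _ (fun i => e i ^+ 2)); apply: le_trans.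
have Esum om : \sum_(i <- iota 0 s.+2) - e i * w i om = - noise s.+2 om.
  by rewrite noiseE -sumrN; apply: eq_bigr => i _; rewrite mulNr.
under [X in (_ <= P X)%E]eq_set do rewrite Esum.
apply: le_measure; rewrite ?inE//.
  rewrite (_ : [set _ | _] = (fun om => noise s.+2 om) @^-1` `]-oo, t]%classic); last first.
    by apply/seteqP; split => om /=; rewrite in_itv/= lerN2.
  by rewrite -[X in measurable X]setTI; exact: measurable_noise.
by move=> om /=; rewrite lerN2 => /ltW.
Qed.

End Noise.

(** * Pull counts *)

Section Counts.
Variables (R : realType) (K : nat) (k0 : 'I_K) (sa : R).
Variables (y : 'I_K -> nat -> R) (w : nat -> 'I_K -> nat -> R).
Implicit Types (t s T L : nat) (k j a : 'I_K).

Local Notation idx := (reboot_index sa y w).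
Local Notation cnt := (reboot_counts k0 sa y w).
Local Notation arm t := (reboot_arm k0 sa y w t (cnt t)).

Lemma reboot_countsS t k : cnt t.+1 k = (cnt t k + (k == arm t))%N.
Proof. by []. Qed.

Lemma reboot_counts_sum T k : cnt T k = (\sum_(t < T) (k == arm t))%N.
Proof.
by elim: T => [|T ih]; [rewrite big_ord0|rewrite big_ord_recr reboot_countsS ih].
Qed.

Lemma reboot_counts_leq t k : (cnt t k <= t)%N.
Proof.
elim: t => // t ih; rewrite reboot_countsS -addn1; apply: leq_add => //.
exact: leq_b1.
Qed.

Lemma reboot_counts_homo k : {homo (cnt^~ k) : t t' / (t <= t')%N}.
Proof. by apply: homo_leq => // [m n p|t]; [exact: leq_trans|exact: leq_addr]. Qed.

Lemma reboot_arm_init t (tK : (t < K)%N) : arm t = Ordinal tK.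
Proof. by rewrite /reboot_arm tK /insubd insubT. Qed.

Lemma reboot_counts_init t k : (t <= K)%N -> cnt t k = (k < t)%N.
Proof.
elim: t => // t ih tK; rewrite reboot_countsS ih ?(ltnW tK)// (reboot_arm_init t tK).
by rewrite -val_eqE/= ltnS (leq_eqVlt k t); case: ltngtP.
Qed.

Lemma reboot_counts_gt0 t k : (K <= t)%N -> (0 < cnt t k)%N.
Proof.
move=> Kt; apply: leq_trans (reboot_counts_homo k _ _ Kt).
by rewrite reboot_counts_init// ltn_ord.
Qed.

Lemma reboot_arm_max t : (K <= t)%N ->
  forall j, idx t j (cnt t j) <= idx t (arm t) (cnt t (arm t)).
Proof.
rewrite leqNgt => /negbTE tK; rewrite /reboot_arm tK.
by case: Order.TotalTheory.arg_maxP => // i _ h j; exact: h.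
Qed.

(** Such a pull raises the count above [s] for good; the induction carries the sharper bound by the
    indicator of [s < cnt T k]. *)
Lemma pulls_at_count T k s :
  (\sum_(t < T) ((k == arm t) && (cnt t k == s)) <= 1)%N.
Proof.
suff: (\sum_(t < T) ((k == arm t) && (cnt t k == s)) <= (s < cnt T k))%N.
  by move=> /leq_trans; apply; exact: leq_b1.
elim: T => [|T ih]; first by rewrite big_ord0.
rewrite reboot_countsS big_ord_recr/=; case: eqP => [ka|ka]/=.
  case: eqP => [cs|cs]; first by move: ih; rewrite cs ltnn leqn0 => /eqP ->; rewrite addn1 ltnSn.
  rewrite addn0 addn1; apply: leq_trans ih _.
  by rewrite ltnS; case: (ltngtP s (cnt T k)).
by rewrite !addn0.
Qed.

Lemma pulls_below_count T k L :
  (\sum_(t < T) ((k == arm t) && (cnt t k <= L)) <= L.+1)%N.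
Proof.
have -> : (\sum_(t < T) ((k == arm t) && (cnt t k <= L)) =
    \sum_(t < T) \sum_(s < L.+1) ((k == arm t) && (cnt t k == s)))%N.
  apply: eq_bigr => t _; case: (k == arm t) => /=; last by rewrite big1.
  case: leqP => [cL|Lc].
    rewrite (bigD1 (Ordinal (cL : (cnt t k < L.+1)%N)))//= eqxx big1// => i.
    by rewrite -val_eqE/= eq_sym => /negbTE ->.
  by rewrite big1// => i _; rewrite gtn_eqF// (leq_trans (ltn_ord i)).
rewrite exchange_big/=; apply: (@leq_trans (\sum_(s < L.+1) 1)).
  by apply: leq_sum => s _; exact: pulls_at_count.
by rewrite sum_nat_const card_ord muln1.
Qed.

(** Every other index lies strictly below that of [k0], so the maximum is attained at [k0] alone. *)
Lemma reboot_arm_best t (tau : R) : (K <= t)%N ->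
  (forall j, j != k0 -> idx t j (cnt t j) < tau) ->
  tau <= idx t k0 (cnt t k0) -> arm t = k0.
Proof.
move=> Kt lt_tau le_tau; apply/eqP; apply: contraT => /lt_tau.
by rewrite ltNge (le_trans le_tau)// reboot_arm_max.
Qed.

(** In round [t] only indices of arms other than [k0] enter, so the fresh weights of [k0] in that
    round do not affect it. *)
Definition others_below t (tau : R) :=
  [forall j, (j != k0) ==> (idx t j (cnt t j) < tau)].

(** The random counts are traded for sums over fixed values [s], so that each remaining event
    concerns a fixed sample size. The three terms are pulls at a small count, overestimation of [k],
    and rounds in which all indices are below [tau]. *)
Lemma reboot_counts_decomp T k L (tau : R) : k != k0 ->
  (cnt T k <= L.+1
    + \sum_(t < T) \sum_(s < T) ((L < s) && (tau <= idx t k s)%R)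
    + \sum_(t < T) \sum_(s < T)
        [&& (K <= t), (0 < s), cnt t k0 == s, others_below t tau
          & (idx t k0 s < tau)%R])%N.
Proof.
move=> kk0; rewrite reboot_counts_sum.
apply: (@leq_trans (\sum_(t < T) (((k == arm t) && (cnt t k <= L)) +
   (\sum_(s < T) ((L < s) && (tau <= idx t k s)%R) +
    \sum_(s < T) [&& (K <= t), (0 < s), cnt t k0 == s, others_below t tau
          & (idx t k0 s < tau)%R])))%N); last first.
  rewrite !big_split/= addnA; do 2 (apply: leq_add => //).
  exact: pulls_below_count.
apply: leq_sum => t _; case: eqP => // ka; case: (leqP (cnt t k) L) => //= Lc.
rewrite add0n.
(* In the initial rounds an arm is pulled at count 0, which [L < cnt t k] excludes. *)
have Kt : (K <= t)%N.
  rewrite leqNgt; apply/negP => tK; move: Lc.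
  rewrite reboot_counts_init ?(ltnW tK)// ka (reboot_arm_init t tK)/= ltnn.
  by rewrite ltn0.
have cT j : (cnt t j < T)%N by rewrite (leq_ltn_trans (reboot_counts_leq t j)).
case: (leP tau (idx t k (cnt t k))) => [le_tau|lt_tau].
  by rewrite (bigD1 (Ordinal (cT k)))//= Lc le_tau.
rewrite addnC (bigD1 (Ordinal (cT k0)))//= eqxx Kt reboot_counts_gt0//=.
have below j : idx t j (cnt t j) < tau.
  by apply: le_lt_trans lt_tau; rewrite ka reboot_arm_max.
have -> : others_below t tau by apply/forallP => j; rewrite below implybT.
by rewrite below.
Qed.

End Counts.

(** * Measurability of the algorithm *)

Section DiscreteMeasurability.
Context {d : measure_display} {X : measurableType d}.

(** Measurability into the discrete sigma-algebra, so that arms, counts and finite tables can be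
    treated as random variables. *)
Definition dmeasurable {T : Type} (f : X -> T) :=
  forall B : set T, measurable (f @^-1` B).

Lemma dmeasurable_countable (T : countType) (f : X -> T) :
  (forall y, measurable (f @^-1` [set y])) -> dmeasurable f.
Proof.
move=> mf B.
rewrite (_ : _ @^-1` _ = \bigcup_y (if `[< B y >] then f @^-1` [set y] else set0)).
  by apply: countable_bigcupT_measurable => // y; case: ifP.
apply/seteqP; split => [x Bx|x [y _]].
  by exists (f x) => //; case: asboolP.
by case: asboolP => //= By fx; rewrite -fx in By.
Qed.

Lemma dmeasurable_comp (T T' : Type) (f : X -> T) (g : T -> T') :
  dmeasurable f -> dmeasurable (g \o f).
Proof. by move=> mf B; exact: (mf (g @^-1` B)). Qed.

Lemma dmeasurable_cst (T : Type) (c : T) : dmeasurable (fun _ : X => c).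
Proof.
move=> B; have [Bc|nBc] := pselect (B c).
  by rewrite (_ : _ @^-1` _ = setT)//; apply/seteqP; split.
by rewrite (_ : _ @^-1` _ = set0)//; apply/seteqP; split.
Qed.

Lemma dmeasurable_ffun (I : finType) (T : countType) (f : I -> X -> T) :
  (forall i, dmeasurable (f i)) -> dmeasurable (fun x => [ffun i => f i x]).
Proof.
move=> mf; apply: dmeasurable_countable => g.
rewrite (_ : _ @^-1` _ = \big[setI/setT]_(i <- enum I) (f i @^-1` [set g i])).
  by apply: bigsetI_measurable => i _; exact: mf.
rewrite -bigcap_seq; apply/seteqP; split => x /=.
  by move=> <- i _ /=; rewrite ffunE.
by move=> h; apply/ffunP => i; rewrite ffunE; apply: h; rewrite /= mem_enum.
Qed.

Lemma dmeasurable_pair (T1 T2 : countType) (f : X -> T1) (g : X -> T2) :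
  dmeasurable f -> dmeasurable g -> dmeasurable (fun x => (f x, g x)).
Proof.
move=> mf mg; apply: dmeasurable_countable => -[a b].
rewrite (_ : _ @^-1` _ = f @^-1` [set a] `&` g @^-1` [set b]).
  by apply: measurableI; [exact: mf|exact: mg].
by apply/seteqP; split => x /= [-> ->].
Qed.

Lemma dmeasurable_bool (f : X -> bool) : measurable [set x | f x] -> dmeasurable f.
Proof.
move=> mf; apply: dmeasurable_countable => -[].
  by rewrite (_ : _ @^-1` _ = [set x | f x]).
rewrite (_ : _ @^-1` _ = ~` [set x | f x]); first exact: measurableC.
by apply/seteqP; split => x /=; [move=> ->|move=> /negP/negbTE].
Qed.

Lemma measurable_ler_set {R : realType} (f g : X -> R) :
  measurable_fun setT f -> measurable_fun setT g -> measurable [set x | f x <= g x].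
Proof.
move=> mf mg.
rewrite (_ : [set _ | _] = setT `&` (fun x => f x <= g x) @^-1` [set true]).
  exact: (measurable_fun_ler mf mg).
by rewrite setTI; apply/seteqP; split => x.
Qed.

Lemma measurable_random_index {R : realType} (N : X -> nat) (F : nat -> X -> R) :
  dmeasurable N -> (forall n, measurable_fun setT (F n)) ->
  measurable_fun setT (fun x => F (N x) x).
Proof.
move=> mN mF _ B mB; rewrite setTI.
rewrite (_ : _ @^-1` _ = \bigcup_n (N @^-1` [set n] `&` F n @^-1` B)).
  apply: bigcupT_measurable => n; apply: measurableI; first exact: mN.
  by rewrite -[X in measurable X]setTI; exact: mF.
by apply/seteqP; split => [x Bx|x [n _ [<-]]//]; exists (N x).
Qed.

End DiscreteMeasurability.

(** * Measurability of the indices and of the counts *)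

Section RebootMeasurability.
Context {R : realType} {d : measure_display} {X : measurableType d}.
Variables (K : nat) (k0 : 'I_K) (sa : R).
Variables (Y : 'I_K -> nat -> X -> R) (W : nat -> 'I_K -> nat -> X -> R).
Hypothesis mY : forall k j, measurable_fun setT (Y k j).

Local Notation yv x := (fun k j => Y k j x).
Local Notation wv x := (fun t k i => W t k i x).

Lemma measurable_reboot_index t k s :
  (forall i, measurable_fun setT (W t k i)) ->
  measurable_fun setT (fun x => reboot_index sa (yv x) (wv x) t k s).
Proof.
move=> mW; rewrite /reboot_index/=.
have mb : measurable_fun setT (fun x => (\sum_(i < s) Y k i x) / s%:R).
  by apply: measurable_funM => //; apply: measurable_sum => i.
apply: measurable_funD => //; apply: measurable_funM => //.
apply: measurable_sum => i; apply: measurable_funM => //.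
case: (i < s)%N; first exact: measurable_funB.
by case: (nat_of_ord i == s); exact: measurable_cst.
Qed.

Local Notation cnt x := (reboot_counts k0 sa (yv x) (wv x)).

Lemma arg_max_pick (F : 'I_K -> R) :
  Order.arg_max k0 xpredT F =
  odflt k0 [pick i | [forall j, F j <= F i]].
Proof. by []. Qed.

(** Measurability is required only of the weights of rounds before [t], so the result also applies
    on the coarser sigma-algebra of the past. *)
Lemma dmeasurable_reboot_counts t :
  (forall t', (t' < t)%N -> forall k i, measurable_fun setT (W t' k i)) ->
  forall k, dmeasurable (fun x => cnt x t k).
Proof.
elim: t => [|t ih] mW k; first exact: dmeasurable_cst.
have mc : forall k, dmeasurable (fun x => cnt x t k).
  by apply: ih => t' t't; apply: mW; exact: ltnW.
pose arm x := reboot_arm k0 sa (yv x) (wv x) t (cnt x t).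
have marm : dmeasurable arm.
  rewrite /arm /reboot_arm; case: (ltnP t K) => _; first exact: dmeasurable_cst.
  pose idx k x := reboot_index sa (yv x) (wv x) t k (cnt x t k).
  have midx j : measurable_fun setT (idx j).
    apply: (measurable_random_index (fun x => cnt x t j)
      (fun n x => reboot_index sa (yv x) (wv x) t j n)) => // n.
    by apply: measurable_reboot_index => i; apply: mW.
  (* The chosen arm is a function [G] of the finite table of comparisons between indices, each of
     which is a measurable event. *)
  pose le_idx i x := [ffun j => idx j x <= idx i x].
  pose G (b : {ffun 'I_K -> {ffun 'I_K -> bool}}) :=
    odflt k0 [pick i | [forall j, b i j]].
  have mle i j : dmeasurable (fun x => idx j x <= idx i x).
    by apply: dmeasurable_bool; exact: measurable_ler_set.
  rewrite (_ : (fun x => _) = G \o (fun x => [ffun i => le_idx i x])).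
    by apply: dmeasurable_comp; apply: dmeasurable_ffun => i; exact: dmeasurable_ffun.
  apply/funext => x; rewrite arg_max_pick /G /=; congr odflt.
  by apply: eq_pick => i /=; apply: eq_forallb => j; rewrite !ffunE.
exact: (dmeasurable_comp _ _ _ (fun p => p.1 + (k == p.2))%N
  (dmeasurable_pair _ _ _ _ (mc k) marm)).
Qed.

End RebootMeasurability.

(** * Regret analysis *)

Lemma indic_bool {R : realType} {X : Type} (b : X -> bool) x :
  \1_[set x | b x] x = (b x)%:R :> R.
Proof. by rewrite indicE; congr ((nat_of_bool _)%:R); apply/idP/idP; rewrite inE. Qed.

Lemma measurable_bool_natr {R : realType} {d} {X : measurableType d} (b : X -> bool) :
  measurable [set x | b x] -> measurable_fun setT (fun x => (b x)%:R : R).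
Proof.
move=> mb; rewrite (_ : (fun _ => _) = \1_[set x | b x]); first exact: measurable_indic.
by apply/funext => x; rewrite indic_bool.
Qed.

Lemma integral_bool_natr {R : realType} {d} {X : measurableType d}
    (P : {measure set X -> \bar R}) (b : X -> bool) :
  measurable [set x | b x] -> (\int[P]_x ((b x)%:R)%:E = P [set x | b x])%E.
Proof.
move=> mb; rewrite -integral_indicT//; apply: eq_integral => x _.
by rewrite indic_bool.
Qed.

(** The partial inverse [g'] transports the sets [B] to the larger family, whose independence is
    known. *)
Lemma mutually_independent_reindex {R : realType} {d} {Omega : measurableType d}
    (P : probability Omega R) (I I' : eqType) (g : I' -> I) (g' : I -> option I')
    (X : I -> Omega -> R) : pcancel g g' ->
  mutually_independent P X -> mutually_independent P (X \o g).
Proof.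
move=> gK indX J B uJ mB.
pose B' z := if g' z is Some i then B i else setT.
have mB' z : measurable (B' z) by rewrite /B'; case: (g' z).
have := indX (map g J) B'; rewrite map_inj_uniq; last exact: pcan_inj gK.
move=> /(_ uJ mB'); rewrite !big_map.
under eq_bigr do rewrite /B' gK.
by under [in RHS]eq_bigr do rewrite /B' gK.
Qed.

Section Residuals.
Context {R : realType}.
Variables (sa : R) (y : nat -> R) (s : nat).

(** Convertible with the local [e] of [reboot_index]. *)
Definition residual (i : nat) : R :=
  if (i < s)%N then y i - sample_mean y s
  else if i == s then Num.sqrt (s.+2)%:R * sa
  else - (Num.sqrt (s.+2)%:R * sa).

Lemma residual_pseudo1 : residual s = Num.sqrt (s.+2)%:R * sa.
Proof. by rewrite /residual ltnn eqxx. Qed.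

Lemma residual_pseudo2 : residual s.+1 = - (Num.sqrt (s.+2)%:R * sa).
Proof. by rewrite /residual ltnNge leqnSn/= gtn_eqF. Qed.

Lemma sum_residual_sq :
  \sum_(i < s.+2) residual i ^+ 2 = residual_ss y s + 2 * (s.+2%:R * sa ^+ 2).
Proof.
rewrite !big_ord_recr/= residual_pseudo1 residual_pseudo2 sqrrN exprMn sqr_sqrtr//.
rewrite (eq_bigr (fun i : 'I_s => (y i - sample_mean y s) ^+ 2)) => [|i _].
  by rewrite -/(residual_ss y s) -addrA mulr_natl mulr2n.
by rewrite /residual ltn_ord.
Qed.

End Residuals.

Lemma reboot_index_ge {R : realType} (K : nat) (sa tau : R)
    (y : 'I_K -> nat -> R) (w : nat -> 'I_K -> nat -> R) t k s :
  (tau <= reboot_index sa y w t k s) =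
  (s.+2%:R * (tau - sample_mean (y k) s) <=
   \sum_(i < s.+2) w t k i * residual sa (y k) s i).
Proof.
have N0 : 0 < s.+2%:R :> R by rewrite ltr0n.
by rewrite -ler_pdivlMl// lerBlDl.
Qed.

(** * Over- and underestimation, and the expected number of pulls *)

Section RebootAnalysis.
Context {R : realType} {d : measure_display} {Omega : measurableType d}.
Variables (P : probability Omega R) (K : nat) (k0 : 'I_K).
Variables (mu : 'I_K -> R) (sa : R).
Variables (Y : 'I_K -> nat -> Omega -> R) (W : nat -> 'I_K -> nat -> Omega -> R).
Hypothesis sa32 : 3 / 2 < sa.
Hypothesis mY : forall k j, measurable_fun setT (Y k j).
Hypothesis mW : forall t k i, measurable_fun setT (W t k i).
Hypothesis lY : forall k j, has_normal_law P (Y k j) (mu k) 1.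
Hypothesis lW : forall t k i, has_normal_law P (W t k i) 0 1.

Let noise_idx := (('I_K * nat) + (nat * 'I_K * nat))%type.
Let X (z : noise_idx) : Omega -> R :=
  match z with inl (k, j) => Y k j | inr (t, k, i) => W t k i end.
Hypothesis indX : mutually_independent P X.

Let sa0 : 0 < sa. Proof. by apply: lt_trans sa32; lra. Qed.
Let sa2 : 9 / 4 <= sa ^+ 2. Proof. by have := sa32; nra. Qed.

Let mX z : measurable_fun setT (X z).
Proof. by case: z => [[k j]|[[t k] i]]; [exact: mY|exact: mW]. Qed.

Let indY k : mutually_independent P (Y k).
Proof.
pose g' (z : noise_idx) : option nat := if z is inl p then Some p.2 else None.
exact: (mutually_independent_reindex P _ _ (fun j => inl (k, j)) g' X _ indX).
Qed.

Let indW t k : mutually_independent P (W t k).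
Proof.
pose g' (z : noise_idx) : option nat := if z is inr p then Some p.2 else None.
exact: (mutually_independent_reindex P _ _ (fun j => inr (t, k, j)) g' X _ indX).
Qed.

Let yv om : 'I_K -> nat -> R := fun k j => Y k j om.
Let wv om : nat -> 'I_K -> nat -> R := fun t k i => W t k i om.
Let idx om t k s := reboot_index sa (yv om) (wv om) t k s.

Variables (dl th : R).
Hypothesis th0 : 0 < th.
Hypothesis th1 : th <= 2 / 3.
Hypothesis hdl : dl = 6 * sa ^+ 2 * th.

(** Equal to [dl^2 / (12 sa^2)] by the relation between [dl] and [th]. *)
Definition chernoff_rate : R := 3 * sa ^+ 2 * th ^+ 2.

Lemma measurable_idx_ge tau t k s : measurable [set om | tau <= idx om t k s].
Proof.
by apply: measurable_ler_set => //; exact: measurable_reboot_index.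
Qed.

(** Rewards are decoupled from weights: the inner integral is bounded by Chernoff for the noise, and
    the outer one by the exponential moment over the rewards. *)
Lemma index_overestimation t k s : (0 < s)%N ->
  (P [set om | (mu k + dl <= idx om t k s)%R] <=
   (expR (- (chernoff_rate * s.+2%:R)))%:E)%E.
Proof.
move=> s0; pose J1 (z : noise_idx) := if z is inl _ then true else false.
pose J2 (z : noise_idx) := if z is inr _ then true else false.
rewrite -integral_bool_natr; last exact: measurable_idx_ge.
have mY1 k' j : measurable_fun setT (Y k' j : sub_space _ X J1 -> R).
  exact: (measurable_sub_space _ X J1 (inl (k', j)) isT).
have mW2 i : measurable_fun setT (W t k i : sub_space _ X J2 -> R).
  exact: (measurable_sub_space _ X J2 (inr (t, k, i)) isT).
pose f (z : sub_space _ X J1 * sub_space _ X J2) : \bar R :=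
  ((mu k + dl <= reboot_index sa (yv z.1) (wv z.2) t k s)%R%:R)%:E.
have mf : measurable_fun setT f.
  apply/measurable_EFinP; apply: measurable_bool_natr.
  apply: measurable_ler_set => //.
  have := @measurable_reboot_index R _ (sub_space _ X J1 * sub_space _ X J2)%type
    K sa (fun k j z => Y k j z.1) (fun t k i z => W t k i z.2).
  apply=> [k' j|i].
    exact: (measurableT_comp (mY1 k' j) measurable_fst).
  exact: (measurableT_comp (mW2 i) measurable_snd).
have f0 z : (0 <= f z)%E by rewrite lee_fin.
have dJ z : J1 z -> ~~ J2 z by case: z.
rewrite (decoupling P _ X mX indX J1 J2 f dJ mf f0).
have := expectation_chernoff_rewards P (Y k) (mu k) (mY k) (lY k) (indY k) s sa dl th
  1 s0 sa2 (ltW th0) th1 hdl (expr1n _ _).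
apply: le_trans; apply: ge0_le_integral => //.
- by move=> om _; apply: integral_ge0.
- exact: (measurable_partial_integral P _ X mX J1 J2 f mf f0).
- by apply/measurable_EFinP; exact: measurable_chernoff_integrand.
move=> om _; rewrite /f/=.
under eq_integral do rewrite reboot_index_ge.
rewrite integral_bool_natr; last first.
  by apply: (measurable_noise_ge (W t k) (mW t k)).
apply: le_trans (noise_chernoff P (W t k) (mW t k) (lW t k) (indW t k) _ _ _ _ th0) _.
rewrite lee_fin ler_expR sum_residual_sq le_eqVlt; apply/orP; left; apply/eqP.
by field.
Qed.

(** The factor of [noise_odds] for pseudo residuals of size [sqrt (s + 2) * sa]; the index reaches
    [m - dl] exactly when the noise reaches [t]. *)
Definition odds_bound (m : R) (y : nat -> R) (s : nat) : R :=
  let t := s.+2%:R * (m - dl - sample_mean y s) in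
  if 0 <= t then 32 * expR (4 / 3 * (t / (2 * (Num.sqrt s.+2%:R * sa))) ^+ 2)
  else 2 * expR (th ^+ 2 * (residual_ss y s + 2 * (s.+2%:R * sa ^+ 2)) / 2 + th * t).

Lemma odds_bound_ge0 m y s : 0 <= odds_bound m y s.
Proof. by rewrite /odds_bound; case: ifP => _; rewrite mulr_ge0 ?expR_ge0. Qed.

Lemma measurable_odds_bound {d'} {T : measurableType d'} (y : nat -> T -> R) m s :
  (forall j, measurable_fun setT (y j)) ->
  measurable_fun setT (fun om => odds_bound m (fun j => y j om) s).
Proof.
move=> my; rewrite /odds_bound/=.
have mm : measurable_fun setT (fun om => s.+2%:R * (m - dl - sample_mean (fun j => y j om) s)).
  by apply: measurable_funM => //; apply: measurable_funB => //; exact: measurable_sample_mean.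
apply: measurable_fun_ifT.
- by apply: measurable_fun_ler.
- apply: measurable_funM => //; apply: measurableT_comp => //; apply: measurable_funM => //.
  by apply: measurable_funX; apply: measurable_funM.
apply: measurable_funM => //; apply: measurableT_comp => //; apply: measurable_funD.
  apply: measurable_funM => //; apply: measurable_funM => //; apply: measurable_funD => //.
  exact: measurable_residual_ss.
exact: measurable_funM.
Qed.

(** Each branch is dominated by one summand, so the expectation requires no case split. In the first
    branch [s + 2 <= 3 s] bounds the quadratic part, and the added linear term is nonnegative since
    [z >= 0]; it produces the decay in [s] of the expectation. *)
Lemma odds_bound_le m y s : (0 < s)%N ->
  odds_bound m y s <= 32 * expR (sa ^- 2 * s%:R * (m - sample_mean y s - dl) ^+ 2
      + s%:R * dl * (m - sample_mean y s - dl)) +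
    2 * expR (th ^+ 2 * (residual_ss y s / 2 + s.+2%:R * sa ^+ 2) +
       (-1) * (th * s.+2%:R) * (sample_mean y s - m) - th * s.+2%:R * dl).
Proof.
move=> s0; set z := m - sample_mean y s - dl; rewrite /odds_bound/=.
have N0 : 0 < s.+2%:R :> R by rewrite ltr0n.
have tz : s.+2%:R * (m - dl - sample_mean y s) = s.+2%:R * z.
  by congr (_ * _); rewrite /z; ring.
have san : sa != 0 by rewrite gt_eqF.
have dl0 : 0 <= dl by rewrite hdl !mulr_ge0// ?sqr_ge0// ltW.
case: ifPn => [|_].
  rewrite tz pmulr_rge0// => z0; apply: ler_wpDr; first by rewrite mulr_ge0 ?expR_ge0.
  rewrite ler_pM2l// ler_expR; apply: ler_wpDr; first by rewrite !mulr_ge0.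
  rewrite !exprMn exprVn !exprMn sqr_sqrtr ?(ltW N0)//.
  rewrite [leLHS](_ : _ = sa ^- 2 * (s.+2%:R / 3) * z ^+ 2); last first.
    by field; rewrite san gt_eqF.
  apply: ler_wpM2r; first exact: sqr_ge0.
  apply: ler_wpM2l; first by rewrite invr_ge0 sqr_ge0.
  have s1 : 1 <= s%:R :> R by rewrite ler1n.
  by rewrite ler_pdivrMr// -addn2 natrD; lra.
apply: ler_wpDl; first by rewrite mulr_ge0 ?expR_ge0.
by rewrite ler_pM2l// ler_expR le_eqVlt; apply/orP; left; apply/eqP; field.
Qed.

Lemma expectation_odds_bound k s : (0 < s)%N ->
  (\int[P]_om (odds_bound (mu k) (yv om k) s)%:E <=
   (32 * ((Num.sqrt (1 - 2 / sa ^+ 2))^-1 * expR (- (s%:R * dl ^+ 2 / 2))) +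
    2 * expR (- (chernoff_rate * s.+2%:R)))%:E)%E.
Proof.
move=> s0.
have mz : measurable_fun setT (fun om => mu k - sample_mean (yv om k) s - dl).
  apply: measurable_funB => //; apply: measurable_funB => //.
  by apply: measurable_sample_mean => j; exact: mY.
pose f om := expR (sa ^- 2 * s%:R * (mu k - sample_mean (yv om k) s - dl) ^+ 2 +
  s%:R * dl * (mu k - sample_mean (yv om k) s - dl)).
pose g om := expR (th ^+ 2 * (residual_ss (yv om k) s / 2 + s.+2%:R * sa ^+ 2) +
  (-1) * (th * s.+2%:R) * (sample_mean (yv om k) s - mu k) - th * s.+2%:R * dl).
have mf : measurable_fun setT f.
  apply: measurableT_comp => //; apply: measurable_funD.
    by apply: measurable_funM => //; apply: measurable_funX.
  exact: measurable_funM.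
have mg : measurable_fun setT g by apply: measurable_chernoff_integrand => j; exact: mY.
apply: (@le_trans _ _ (\int[P]_om (32%:E * (f om)%:E + 2%:E * (g om)%:E))%E).
  apply: ge0_le_integral => //.
  - by move=> om _; rewrite lee_fin odds_bound_ge0.
  - by apply/measurable_EFinP; apply: measurable_odds_bound => j; exact: mY.
  - by apply: emeasurable_funD; apply/measurable_EFinP; exact: measurable_funM.
  - by move=> om _; rewrite -!EFinM -EFinD lee_fin odds_bound_le.
rewrite ge0_integralD//; last 4 first.
- by move=> om _; rewrite -EFinM lee_fin mulr_ge0 ?expR_ge0.
- by apply/measurable_EFinP; exact: measurable_funM.
- by move=> om _; rewrite -EFinM lee_fin mulr_ge0 ?expR_ge0.
- by apply/measurable_EFinP; exact: measurable_funM.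
rewrite !ge0_integralZl//; last 4 first.
- by apply/measurable_EFinP.
- by move=> om _; rewrite lee_fin expR_ge0.
- by apply/measurable_EFinP.
- by move=> om _; rewrite lee_fin expR_ge0.
rewrite [leRHS]EFinD; apply: leeD; rewrite [leRHS]EFinM; apply: lee_wpmul2l => //.
  have b0 : 0 <= sa ^- 2 by rewrite invr_ge0 sqr_ge0.
  (* Integrability of the Gaussian quadratic, from [sa^2 >= 9/4 > 2]. *)
  have b2 : sa ^- 2 < 2^-1.
    by rewrite ltf_pV2 ?posrE//; [apply: lt_le_trans sa2; lra|rewrite exprn_gt0].
  have := expectation_exp_mean_sq P (Y k) (mu k) (mY k) (lY k) (indY k) s (sa ^- 2) dl s0 b0 b2.
  by move=> ->; rewrite EFinM.
have N1 : (-1 : R) ^+ 2 = 1 by rewrite sqrrN expr1n.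
exact: (expectation_chernoff_rewards P (Y k) (mu k) (mY k) (lY k) (indY k) s sa dl th
  (-1) s0 sa2 (ltW th0) th1 hdl N1).
Qed.

Definition under_event (tau : R) (t s : nat) (om : Omega) : bool :=
  [&& (K <= t)%N, (0 < s)%N, reboot_counts k0 sa (yv om) (wv om) t k0 == s,
      others_below R K k0 sa (yv om) (wv om) t tau & idx om t k0 s < tau].

Definition pull_event (t s : nat) (om : Omega) : bool :=
  (k0 == reboot_arm k0 sa (yv om) (wv om) t (reboot_counts k0 sa (yv om) (wv om) t))
  && (reboot_counts k0 sa (yv om) (wv om) t k0 == s).

(** Stated for arbitrary tables so as to hold both on [Omega] and on the coarser space generated by
    the rewards, the earlier weights, and the other arms' weights in round [t]. *)
Lemma measurable_past {d'} {T : measurableType d'} (y : 'I_K -> nat -> T -> R)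
    (w : nat -> 'I_K -> nat -> T -> R) tau t s :
  (forall k j, measurable_fun setT (y k j)) ->
  (forall t' k i, (t' < t)%N || (t' == t) && (k != k0) ->
     measurable_fun setT (w t' k i)) ->
  measurable [set om | [&& (K <= t)%N, (0 < s)%N,
     reboot_counts k0 sa (fun k j => y k j om) (fun t k i => w t k i om) t k0 == s &
     others_below R K k0 sa (fun k j => y k j om) (fun t k i => w t k i om) t tau]].
Proof.
move=> my mw.
have mc k : dmeasurable (fun om => reboot_counts k0 sa (fun k j => y k j om)
    (fun t k i => w t k i om) t k).
  by apply: dmeasurable_reboot_counts => // t' t't k' i; apply: mw; rewrite t't.
rewrite (_ : [set _ | _] = [set om | (K <= t)%N && (0 < s)%N] `&`
  ((fun om => reboot_counts k0 sa (fun k j => y k j om) (fun t k i => w t k i om) t k0)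
    @^-1` [set s] `&`
   \big[setI/setT]_(j <- enum 'I_K) [set om | (j != k0) ==>
     (reboot_index sa (fun k j => y k j om) (fun t k i => w t k i om) t j
       (reboot_counts k0 sa (fun k j => y k j om) (fun t k i => w t k i om) t j) < tau)])).
  apply: measurableI; first exact: (dmeasurable_cst _ ((K <= t)%N && (0 < s)%N) [set true]).
  apply: measurableI; first exact: mc.
  apply: bigsetI_measurable => j _; case: (boolP (j == k0)) => [_|jk0].
    by rewrite (_ : [set _ | _] = setT)//; apply/seteqP; split.
  pose F om := reboot_index sa (fun k j => y k j om) (fun t k i => w t k i om) t j
    (reboot_counts k0 sa (fun k j => y k j om) (fun t k i => w t k i om) t j).
  have mF : measurable_fun setT F.
    apply: (measurable_random_index _ (fun n om => reboot_index sa
      (fun k j => y k j om) (fun t k i => w t k i om) t j n)) => // n.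
    apply: measurable_reboot_index => // i.
    by apply: mw; rewrite eqxx jk0 orbT.
  rewrite (_ : [set _ | _] = ~` [set om | tau <= F om]).
    by apply: measurableC; exact: measurable_ler_set.
  by apply/seteqP; split => om /=; rewrite ltNge => /negP.
rewrite -bigcap_seq; apply/seteqP; split => om /=.
  move=> /and4P[Kt s0 /eqP cs /forallP h]; rewrite Kt s0; split => //; split => //.
  by move=> j _ /=; exact: h.
move=> [/andP[-> ->] [-> h]]; rewrite eqxx/=; apply/forallP => j.
by apply: h; rewrite /= mem_enum.
Qed.

Lemma measurable_pull_event t s : measurable [set om | pull_event t s om].
Proof.
have mc t' k : dmeasurable (fun om => reboot_counts k0 sa (yv om) (wv om) t' k).
  by apply: dmeasurable_reboot_counts => // ? _ ? ?; exact: mW.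
(* A pull of [k0] in round [t] is read off from its counts at [t] and [t + 1]. *)
have := dmeasurable_comp _ _ _ (fun p => (p.1.1.+1 == p.1.2) && (p.2 == s))
  (dmeasurable_pair _ _ _ _ (dmeasurable_pair _ _ _ _ (mc t k0) (mc t.+1 k0)) (mc t k0)).
move=> /(_ [set true]); congr measurable.
have E om : ((reboot_counts k0 sa (yv om) (wv om) t k0).+1 ==
    reboot_counts k0 sa (yv om) (wv om) t.+1 k0) &&
    (reboot_counts k0 sa (yv om) (wv om) t k0 == s) = pull_event t s om.
  by rewrite reboot_countsS -addn1 eqn_add2l /pull_event; case: (k0 == _).
by apply/seteqP; split => om; rewrite /= E.
Qed.

(* Conditionally on the rewards and on all the other weights, the index of [k0]
   falls below [tau] with odds at most [odds_bound]; when it does not, [k0] is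
   pulled. *)
Lemma underestimation_transfer t s :
  (P [set om | under_event (mu k0 - dl) t s om] <=
   \int[P]_om ((pull_event t s om)%:R * odds_bound (mu k0) (yv om k0) s)%:E)%E.
Proof.
set tau := mu k0 - dl.
pose J1 (z : noise_idx) := if z is inr (t', k, i)
  then (t' < t)%N || (t' == t) && (k != k0) else true.
pose J2 (z : noise_idx) := if z is inr (t', k, i) then (t' == t) && (k == k0) else false.
have dJ z : J1 z -> ~~ J2 z.
  case: z => [//|[[t' k] i]] /= /orP[t't|/andP[_ kk0]]; first by rewrite (ltn_eqF t't).
  by rewrite (negbTE kk0) andbF.
pose T1 := sub_space _ X J1; pose T2 := sub_space _ X J2.
have mY1 k j : measurable_fun setT (Y k j : T1 -> R).
  exact: (measurable_sub_space _ X J1 (inl (k, j)) isT).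
have mW1 t' k i : (t' < t)%N || (t' == t) && (k != k0) ->
    measurable_fun setT (W t' k i : T1 -> R).
  exact: (measurable_sub_space _ X J1 (inr (t', k, i))).
have mW2 i : measurable_fun setT (W t k0 i : T2 -> R).
  by apply: (measurable_sub_space _ X J2 (inr (t, k0, i))); rewrite /= !eqxx.
pose A om := [&& (K <= t)%N, (0 < s)%N,
  reboot_counts k0 sa (yv om) (wv om) t k0 == s &
  others_below R K k0 sa (yv om) (wv om) t tau].
have mA1 : measurable ([set om | A om] : set T1) by exact: measurable_past.
have mA : measurable [set om : Omega | A om].
  by apply: measurable_past => //; exact: mY.
pose b (z : T1 * T2) := tau <= reboot_index sa (yv z.1) (wv z.2) t k0 s.
have mb : measurable [set z | b z].
  apply: measurable_ler_set => //.
  have := @measurable_reboot_index R _ (T1 * T2)%type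
    K sa (fun k j z => Y k j z.1) (fun t k i z => W t k i z.2).
  apply=> [k' j|i].
    exact: (measurableT_comp (mY1 k' j) measurable_fst).
  exact: (measurableT_comp (mW2 i) measurable_snd).
have mbA (c : T1 * T2 -> R) : measurable_fun setT c ->
    measurable_fun setT (fun z : T1 * T2 => ((A z.1)%:R * c z)%:E).
  move=> mc; apply/measurable_EFinP; apply: measurable_funM => //.
  exact: (measurableT_comp (measurable_bool_natr _ mA1) measurable_fst).
(* [f] is the indicator of the bad round; [g] replaces the failure of [b] by its success times the
   odds bound. They are compared after integrating [z.2] with [z.1] frozen. *)
pose f (z : T1 * T2) : \bar R := ((A z.1)%:R * (~~ b z)%:R)%:E.
pose g (z : T1 * T2) : \bar R :=
  ((A z.1)%:R * (odds_bound (mu k0) (yv z.1 k0) s * (b z)%:R))%:E.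
have mf : measurable_fun setT f.
  apply: mbA; apply: measurable_bool_natr.
  rewrite (_ : [set _ | _] = ~` [set z | b z]); first exact: measurableC.
  by apply/seteqP; split => z /=; move/negP.
have mg : measurable_fun setT g.
  apply: mbA; apply: measurable_funM; last exact: measurable_bool_natr.
  exact: (measurableT_comp (measurable_odds_bound _ (mu k0) s (mY1 k0)) measurable_fst).
have f0 z : (0 <= f z)%E by rewrite lee_fin mulr_ge0.
have g0 z : (0 <= g z)%E by rewrite lee_fin !mulr_ge0// odds_bound_ge0.
have mU : measurable [set om | under_event tau t s om].
  rewrite (_ : [set _ | _] = [set om | A om] `&` ~` [set om | tau <= idx om t k0 s]).
    by apply: measurableI => //; apply: measurableC; exact: measurable_idx_ge.
  apply/seteqP; split => om /=; rewrite /under_event /A.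
    by move=> /and5P[-> -> -> -> /=]; rewrite ltNge => /negP.
  by move=> [/and4P[-> -> -> ->] /negP]; rewrite -ltNge.
rewrite -(integral_bool_natr P)//.
have -> : (\int[P]_om ((under_event tau t s om)%:R)%:E = \int[P]_om f (om, om))%E.
  apply: eq_integral => om _; rewrite /f /b /under_event /A /= -ltNge.
  by rewrite -natrM mulnb -!andbA.
rewrite (decoupling P _ X mX indX J1 J2 f dJ mf f0).
apply: (@le_trans _ _ (\int[P]_om1 \int[P]_om2 g (om1, om2))%E).
  apply: ge0_le_integral => //.
  - by move=> om _; apply: integral_ge0.
  - exact: (measurable_partial_integral P _ X mX J1 J2 f mf f0).
  - exact: (measurable_partial_integral P _ X mX J1 J2 g mg g0).
  move=> om1 _; rewrite /f /g /=; case: (boolP (A om1)) => [Aom1|_]; last first.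
    by under eq_integral do rewrite mul0r; under [leRHS]eq_integral do rewrite mul0r.
  have s0 : (0 < s)%N by move: Aom1 => /and4P[].
  under eq_integral do rewrite mul1r.
  under [leRHS]eq_integral do rewrite mul1r EFinM.
  have mge : measurable [set om2 : Omega | b (om1, om2)].
    rewrite (_ : [set _ | _] = [set om2 | s.+2%:R * (tau - sample_mean (yv om1 k0) s) <=
        \sum_(i < s.+2) W t k0 i om2 * residual sa (yv om1 k0) s i]).
      exact: (measurable_noise_ge (W t k0) (mW t k0)).
    by apply/seteqP; split => om2 /=; rewrite /b /= reboot_index_ge.
  have mlt : measurable [set om2 : Omega | ~~ b (om1, om2)].
    rewrite (_ : [set _ | _] = ~` [set om2 | b (om1, om2)]); first exact: measurableC.
    by apply/seteqP; split => z /=; move/negP.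
  have o0 : (0 <= (odds_bound (mu k0) (yv om1 k0) s)%:E)%E by rewrite lee_fin odds_bound_ge0.
  rewrite ge0_integralZl//; last by apply/measurable_EFinP; exact: measurable_bool_natr.
  rewrite (integral_bool_natr P (fun om2 => ~~ b (om1, om2)))//.
  rewrite (integral_bool_natr P (fun om2 => b (om1, om2)))//.
  have a0 : 0 < Num.sqrt s.+2%:R * sa by rewrite mulr_gt0// sqrtr_gt0.
  have := noise_odds P (W t k0) (mW t k0) (lW t k0) (indW t k0)
    (residual sa (yv om1 k0) s) s _ th (s.+2%:R * (tau - sample_mean (yv om1 k0) s))
    a0 (residual_pseudo1 _ _ _) (residual_pseudo2 _ _ _) th0.
  rewrite sum_residual_sq.
  rewrite (_ : [set om2 | ~~ b (om1, om2)] = [set om2 |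
     (\sum_(i < s.+2) W t k0 i om2 * residual sa (yv om1 k0) s i <
      s.+2%:R * (tau - sample_mean (yv om1 k0) s))%R]); last first.
    by apply/seteqP; split => om2 /=; rewrite /b /= reboot_index_ge -ltNge.
  rewrite (_ : [set om2 | b (om1, om2)] = [set om2 |
     (s.+2%:R * (tau - sample_mean (yv om1 k0) s) <=
      \sum_(i < s.+2) W t k0 i om2 * residual sa (yv om1 k0) s i)%R]); last first.
    by apply/seteqP; split => om2 /=; rewrite /b /= reboot_index_ge.
  by [].
(* Recoupling is possible because the odds bound depends on the rewards only, hence on the first
   block. *)
rewrite -(decoupling P _ X mX indX J1 J2 g dJ mg g0).
have mG : measurable_fun setT (fun om : Omega => g (om, om)).
  have mdiag : measurable_fun setT (fun om : Omega => (sub_id _ X J1 om, sub_id _ X J2 om)).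
    by apply/measurable_fun_pair; exact: measurable_sub_id.
  exact: (measurableT_comp mg mdiag).
apply: ge0_le_integral => //.
- apply/measurable_EFinP; apply: measurable_funM.
    by apply: measurable_bool_natr; exact: measurable_pull_event.
  by apply: measurable_odds_bound => j; exact: mY.
move=> om _; rewrite /g lee_fin /= mulrCA [leRHS]mulrC.
apply: ler_wpM2l; first exact: odds_bound_ge0.
rewrite -natrM mulnb ler_nat; case: (boolP (A om)) => //= /and4P[Kt _ cs below].
case: (boolP (b (om, om))) => //= bom; rewrite /pull_event cs andbT.
rewrite (reboot_arm_best R K k0 sa (yv om) (wv om) t tau)//.
- by rewrite eqxx.
- by move=> j jk0; move/forallP: below => /(_ j); rewrite jk0.
- by rewrite (eqP cs).
Qed.

Lemma measurable_under_event tau t s : measurable [set om | under_event tau t s om].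
Proof.
have mA := measurable_past Y W tau t s mY (fun t' k i _ => mW t' k i).
have := measurableD mA (measurable_idx_ge tau t k0 s); congr measurable.
apply/seteqP; split => om /=; rewrite /under_event.
  by move=> [/and4P[-> -> -> ->] /negP]; rewrite -ltNge.
by move=> /and5P[-> -> -> -> /=]; rewrite ltNge => /negP.
Qed.

(** For fixed [s] the pull indicators sum to at most 1 over the rounds, so each count [s] costs its
    expected odds bound once. *)
Lemma under_event_sum T :
  (\sum_(t < T) \sum_(s < T) P [set om | under_event (mu k0 - dl) t s om] <=
   \sum_(s < T | (0 < s)%N)
     \int[P]_om (odds_bound (mu k0) (yv om k0) s)%:E)%E.
Proof.
rewrite exchange_big/= [leRHS]big_mkcond/=; apply: lee_sum => s _.
case: ifPn => [s0|]; last first.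
  rewrite -leqNgt leqn0 => /eqP s0; rewrite big1// => t _.
  rewrite (_ : [set _ | _] = set0) ?measure0//.
  by apply/seteqP; split => om //=; rewrite /under_event s0 andbF.
have mo : measurable_fun setT (fun om => odds_bound (mu k0) (yv om k0) s).
  by apply: measurable_odds_bound => j; exact: mY.
have mp (t : nat) : measurable_fun setT (fun om =>
    ((pull_event t s om)%:R * odds_bound (mu k0) (yv om k0) s)%:E).
  apply/measurable_EFinP; apply: measurable_funM => //.
  by apply: measurable_bool_natr; exact: measurable_pull_event.
apply: (@le_trans _ _ (\sum_(t < T)
    \int[P]_om ((pull_event t s om)%:R * odds_bound (mu k0) (yv om k0) s)%:E)%E).
  by apply: lee_sum => t _; exact: underestimation_transfer.
rewrite -ge0_integral_sum//; last first.
  by move=> t om _; rewrite lee_fin mulr_ge0// odds_bound_ge0.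
apply: ge0_le_integral => //.
- by move=> om _; apply: sume_ge0 => t _; rewrite lee_fin mulr_ge0// odds_bound_ge0.
- by apply: emeasurable_sum => t.
- exact/measurable_EFinP.
move=> om _; rewrite sumEFin lee_fin -mulr_suml.
apply: ler_piMl; first exact: odds_bound_ge0.
rewrite -natr_sum (ler_nat _ _ 1).
exact: (pulls_at_count R K k0 sa (yv om) (wv om) T k0 s).
Qed.

(** The pathwise decomposition is integrated at [tau = mu k0 - dl]. The gap places [tau] above
    [mu k + dl], so the overestimation bound applies in each of the [T] rounds. *)
Lemma expected_counts_le k T L : k != k0 -> mu k + dl <= mu k0 - dl ->
  (\int[P]_om ((reboot_counts k0 sa (yv om) (wv om) T k)%:R)%:E <=
   (L.+1%:R + T%:R * (\sum_(s < T | (L < s)%N) expR (- (chernoff_rate * s.+2%:R)))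
    + \sum_(s < T | (0 < s)%N)
       (32 * ((Num.sqrt (1 - 2 / sa ^+ 2))^-1 * expR (- (s%:R * dl ^+ 2 / 2))) +
        2 * expR (- (chernoff_rate * s.+2%:R))))%:E)%E.
Proof.
move=> kk0 gap; set tau := mu k0 - dl.
pose over (t s : nat) om := (L < s)%N && (tau <= idx om t k s).
have mover (t s : nat) : measurable [set om | over t s om].
  rewrite /over; case: (L < s)%N => /=; first exact: measurable_idx_ge.
  by rewrite (_ : [set _ | _] = set0)//; apply/seteqP; split.
have munder (t s : nat) := measurable_under_event tau t s.
pose o (t s : nat) om : \bar R := ((over t s om)%:R)%:E.
pose u (t s : nat) om : \bar R := ((under_event tau t s om)%:R)%:E.
have mo t s : measurable_fun setT (o t s).
  by apply/measurable_EFinP; exact: measurable_bool_natr.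
have mu' t s : measurable_fun setT (u t s).
  by apply/measurable_EFinP; exact: measurable_bool_natr.
have o0 t s om : (0 <= o t s om)%E by rewrite lee_fin.
have u0 t s om : (0 <= u t s om)%E by rewrite lee_fin.
have msum (v : nat -> nat -> Omega -> \bar R) : (forall t s, measurable_fun setT (v t s)) ->
    measurable_fun setT (fun om => \sum_(t < T) \sum_(s < T) v t s om)%E.
  by move=> mv; apply: emeasurable_sum => t; exact: emeasurable_sum.
have sum0 (v : nat -> nat -> Omega -> \bar R) om : (forall t s om, 0 <= v t s om)%E ->
    (0 <= \sum_(t < T) \sum_(s < T) v t s om)%E.
  by move=> v0; apply: sume_ge0 => t _; exact: sume_ge0.
have intsum (v : nat -> nat -> Omega -> \bar R) : (forall t s, measurable_fun setT (v t s)) ->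
    (forall t s om, 0 <= v t s om)%E ->
    (\int[P]_om (\sum_(t < T) \sum_(s < T) v t s om) =
     \sum_(t < T) \sum_(s < T) \int[P]_om v t s om)%E.
  move=> mv v0; rewrite ge0_integral_sum//.
  - by apply: eq_bigr => t _; rewrite ge0_integral_sum.
  - by move=> t; exact: emeasurable_sum.
  - by move=> t om _; exact: sume_ge0.
apply: (@le_trans _ _ (\int[P]_om ((L.+1%:R)%:E +
    ((\sum_(t < T) \sum_(s < T) o t s om) + (\sum_(t < T) \sum_(s < T) u t s om))))%E).
  apply: ge0_le_integral => //.
  - apply/measurable_EFinP.
    have mc : dmeasurable (fun om => reboot_counts k0 sa (yv om) (wv om) T k).
      by apply: dmeasurable_reboot_counts => // ? _ ? ?; exact: mW.
    by apply: (measurable_random_index _ (fun n _ => n%:R)).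
  - by apply: emeasurable_funD => //; apply: emeasurable_funD; exact: msum.
  move=> om _; rewrite /o /u.
  under eq_bigr do rewrite sumEFin; under [X in (_ + (_ + X))%E]eq_bigr do rewrite sumEFin.
  rewrite !sumEFin -!EFinD lee_fin.
  have := reboot_counts_decomp R K k0 sa (yv om) (wv om) T k L tau kk0.
  rewrite -(ler_nat R) => /le_trans; apply.
  rewrite !natrD -addrA lerD2l; apply: lerD; rewrite natr_sum; apply: ler_sum => t _;
    by rewrite natr_sum.
rewrite ge0_integralD//; last 2 first.
- by move=> om _; apply: adde_ge0; exact: sum0.
- by apply: emeasurable_funD; exact: msum.
rewrite ge0_integralD//; last 4 first.
- by move=> om _; exact: sum0.
- exact: msum.
- by move=> om _; exact: sum0.
- exact: msum.
have cstE : (\int[P]_om (L.+1%:R)%:E = (L.+1%:R : R)%:E)%E.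
  by rewrite integral_cst// -[RHS]mule1; congr (_ * _)%E; exact: probability_setT.
rewrite !intsum// cstE.
rewrite -addrA [leRHS]EFinD; apply: leeD => //.
rewrite EFinD; apply: leeD.
  have -> : T%:R * (\sum_(s < T | (L < s)%N) expR (- (chernoff_rate * s.+2%:R))) =
     \sum_(t < T) \sum_(s < T | (L < s)%N) expR (- (chernoff_rate * s.+2%:R)).
    by rewrite sumr_const card_ord mulr_natl.
  rewrite -sumEFin; apply: lee_sum => t _; rewrite -sumEFin [leRHS]big_mkcond/=.
  apply: lee_sum => s _; rewrite /o (integral_bool_natr P)// /over.
  case: ifPn => [Ls|_] /=; last first.
    by rewrite (_ : [set _ | _] = set0) ?measure0//; apply/seteqP; split.
  apply: le_trans (index_overestimation t k s (leq_ltn_trans (leq0n L) Ls)).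
  apply: le_measure; rewrite ?inE; [exact: measurable_idx_ge|exact: measurable_idx_ge|].
  by move=> om /=; exact: le_trans.
apply: (@le_trans _ _ (\sum_(t < T) \sum_(s < T) P [set om | under_event tau t s om])%E).
  by apply: lee_sum => t _; apply: lee_sum => s _; rewrite /u (integral_bool_natr P).
apply: le_trans (under_event_sum T) _.
rewrite -sumEFin; apply: lee_sum => s s0; exact: expectation_odds_bound.
Qed.

Lemma expected_counts k T : (0 < T)%N -> k != k0 -> mu k + dl <= mu k0 - dl ->
  (\int[P]_om ((reboot_counts k0 sa (yv om) (wv om) T k)%:R)%:E <=
   (1 + (ln T%:R + 3) / chernoff_rate
    + 64 * (Num.sqrt (1 - 2 / sa ^+ 2))^-1 / dl ^+ 2)%:E)%E.
Proof.
move=> T0 kk0 gap; set r := chernoff_rate; set q := (Num.sqrt _)^-1.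
have r0 : 0 < r by rewrite /r /chernoff_rate !mulr_gt0// ?exprn_gt0.
have dl0 : 0 < dl by rewrite hdl !mulr_gt0// ?exprn_gt0.
have q0 : 0 <= q by rewrite invr_ge0 sqrtr_ge0.
have T1 : 1 <= T%:R :> R by rewrite ler1n.
have lnT : 0 <= ln T%:R :> R by exact: ln_ge0.
(* Chosen so that [T exp (- r (L + 1)) <= 1]. *)
pose L := Num.truncn (ln T%:R / r).
have /andP[LT TL] : L%:R <= ln T%:R / r < L.+1%:R.
  by rewrite /L truncn_itv// divr_ge0// ltW.
apply: le_trans (expected_counts_le k T L kk0 gap) _; rewrite lee_fin.
have shift (s : nat) : expR (- (r * s.+2%:R)) = expR (- (2 * r)) * expR (- (r * s%:R)).
  by rewrite -expRD -addn2 natrD; congr expR; ring.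
have e2 : expR (- (2 * r)) <= expR (- r) by rewrite ler_expR; lra.
have e1 : expR (- r) <= 1 by rewrite -expR0 ler_expR; lra.
(* The shift from [s] to [s + 2] supplies the factor [exp (- r)] that turns [L] into [L + 1]. *)
have Tover : T%:R * \sum_(s < T | (L < s)%N) expR (- (r * s.+2%:R)) <= r^-1.
  under eq_bigr do rewrite shift.
  rewrite -mulr_sumr.
  apply: (@le_trans _ _ (T%:R * (expR (- r) * (expR (- (r * L%:R)) / r)))).
    rewrite ler_pM2l; last lra.
    apply: ler_pM => //; last exact: geometric_tail_le.
    by apply: sumr_ge0 => s _; exact: expR_ge0.
  rewrite [leLHS](_ : _ = T%:R * (expR (- r) * expR (- (r * L%:R))) * r^-1); last by ring.
  rewrite ler_piMl ?invr_ge0 ?(ltW r0)//.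
  rewrite -expRD (_ : - r + - (r * L%:R) = - (L.+1%:R * r)); last by rewrite -natr1; ring.
  have T0' : (T%:R : R) \is Num.pos by rewrite posrE; lra.
  rewrite -[X in X * _](lnK T0') -expRD -[leRHS]expR0 ler_expR subr_le0.
  by rewrite -(ler_pdivrMr _ _ r0) ltW.
have sum2 : \sum_(s < T | (0 < s)%N) expR (- (r * s.+2%:R)) <= r^-1.
  apply: (@le_trans _ _ (\sum_(s < T | (0 < s)%N) expR (- (r * s%:R)))).
    apply: ler_sum => s _; rewrite shift; apply: ler_piMl; [exact: expR_ge0|exact: le_trans e2 e1].
  by apply: le_trans (geometric_tail_le _ _ _ r0) _; rewrite mulr0 oppr0 expR0 mul1r.
have sum1 : \sum_(s < T | (0 < s)%N) expR (- (s%:R * dl ^+ 2 / 2)) <= 2 / dl ^+ 2.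
  rewrite (eq_bigr (fun s : 'I_T => expR (- (dl ^+ 2 / 2 * s%:R)))); last first.
    by move=> s _; congr (expR (- _)); ring.
  have d2 : 0 < dl ^+ 2 / 2 by rewrite mulr_gt0// exprn_gt0.
  by apply: le_trans (geometric_tail_le _ _ _ d2) _; rewrite mulr0 oppr0 expR0 mul1r invf_div.
rewrite big_split/= -!mulr_sumr.
have h1 : 32 * (q * \sum_(s < T | (0 < s)%N) expR (- (s%:R * dl ^+ 2 / 2))) <=
    64 * q / dl ^+ 2.
  rewrite [leRHS](_ : _ = 32 * (q * (2 / dl ^+ 2))); last by ring.
  by rewrite ler_pM2l// ler_wpM2l.
(* The 3 collects one [1 / r] from overestimation and two from the second term of the odds bound. *)
have -> : (ln T%:R + 3) / r = ln T%:R / r + 3 * r^-1 by rewrite mulrDl.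
rewrite -natr1; move: Tover sum2 h1 LT.
set a := T%:R * _; set b := \sum_(_ < _ | _) _; set c := 32 * _.
lra.
Qed.

End RebootAnalysis.

(** * Comparison of constants and the regret bound *)

Lemma ln_nat_ge_half {R : realType} (T : nat) : (2 <= T)%N -> 2^-1 <= ln T%:R :> R.
Proof.
move=> T2; have T2' : 2 <= T%:R :> R by rewrite (ler_nat _ 2).
have h : expR 2^-1 <= (2 : R).
  rewrite -[expR _]invrK -expRN -[leRHS]invrK lef_pV2 ?posrE ?expR_gt0//.
  by apply: le_trans (expR_ge1Dx _); lra.
by rewrite -[leLHS]expRK ler_ln ?posrE ?expR_gt0//; [exact: le_trans T2'|lra].
Qed.

Lemma regret_constants {R : realType} (sa D x dl th : R) : 3 / 2 < sa ->
  0 < D -> 2^-1 <= x -> dl = Num.min (D / 2) (4 * sa ^+ 2) ->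
  th = dl / (6 * sa ^+ 2) ->
  1 + (x + 3) / (3 * sa ^+ 2 * th ^+ 2)
    + 64 * (Num.sqrt (1 - 2 / sa ^+ 2))^-1 / dl ^+ 2
  <= 6 + (C1 sa + C2 sa * D ^- 2) * x.
Proof.
move=> sa32 D0 x2 hdl hth.
set V := sa ^+ 2; set q := (Num.sqrt _)^-1.
have V94 : 9 / 4 < V by rewrite /V; nra.
have V0 : 0 < V by lra.
have Vn : V != 0 by rewrite gt_eqF.
have Vi : V^-1 < 4 / 9 by rewrite -[ltRHS]invrK ltf_pV2 ?posrE ?invr_gt0// invf_div; lra.
have Vi0 : 0 < V^-1 by rewrite invr_gt0.
(* [V > 9/4] gives [1 - 2 / V > 1/9], whence [q <= 3]. *)
have sq3 : 1 / 3 <= Num.sqrt (1 - 2 / V).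
  rewrite -[leLHS]ger0_norm// -sqrtr_sqr ler_sqrt; lra.
have q0 : 0 < q by rewrite invr_gt0; lra.
have q3 : q <= 3 by rewrite -[leRHS]invrK lef_pV2 ?posrE ?invr_gt0//; lra.
have dl0 : 0 < dl by rewrite hdl lt_min divr_gt0//= mulr_gt0.
have dln : dl != 0 by rewrite gt_eqF.
have rE : (3 * V * th ^+ 2)^-1 = 12 * V * dl ^- 2.
  by rewrite hth -/V; field; rewrite Vn dln.
have c1 : 0 <= C1 sa by rewrite /C1 -/V divr_ge0//; lra.
rewrite -/V rE /C2 -/V.
set p := (Num.sqrt (1 - 225 / 100 / V))^-1.
rewrite [2 / _](_ : _ = 2 * p)//.
have p0 : 0 <= p by rewrite invr_ge0 sqrtr_ge0.
have x0 : 0 <= x by lra.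
(* For small gaps [dl = D / 2] and the [C2] term absorbs everything of order [D^-2]; for large gaps
   [dl = 4 V] and the [C1] term with the constant 6 suffices. *)
case: (leP (D / 2) (4 * V)) => DV.
  have dE : dl ^- 2 = 4 * D ^- 2.
    by rewrite hdl -/V (min_idPl DV); field; rewrite gt_eqF.
  rewrite dE; set u := D ^- 2; have u0 : 0 <= u by rewrite invr_ge0 sqr_ge0.
  have qp : q <= p.
    rewrite lef_pV2 ?posrE; last 2 first.
    - by rewrite sqrtr_gt0; lra.
    - by rewrite sqrtr_gt0; lra.
    by rewrite ler_sqrt; lra.
  have VX : 9 / 8 <= V * x by nra.
  (* The coefficient [128 * 3.1 = 396.8] is split into 48, for the part already proportional to [x],
     and 348.8, which covers 144 since [x >= 1/2]. *)
  have h1 : 144 * V * u <= 3488 / 10 * (V * x) * u.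
    by apply: ler_wpM2r => //; nra.
  have h2 : 256 * q * u <= 256 * (p * (V * x)) * u.
    by apply: ler_wpM2r => //; nra.
  have h3 : 0 <= C1 sa * x by exact: mulr_ge0.
  nra.
(* Apart from the term in [x], the left side is at most [1 + 1 + 64/27], which is below 6. *)
have dE : dl = 4 * V by rewrite hdl -/V; apply: min_r; exact: ltW.
have dE2 : dl ^- 2 = 16^-1 * V^-1 ^+ 2 by rewrite dE; field.
have hC1 : 3 / 4 * V^-1 <= C1 sa.
  rewrite /C1 -/V ler_pdivlMr; last lra.
  rewrite [leLHS](_ : _ = 3 / 2 - 3 / 4 * V^-1); last by field.
  lra.
have hC2 : 0 <= 128 * V * (31 / 10 + 2 * p) * D ^- 2 * x.
  by rewrite !mulr_ge0 ?invr_ge0 ?sqr_ge0//; lra.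
have h1 : 3 / 4 * V^-1 * x <= C1 sa * x by exact: ler_wpM2r.
have h2 : q * V^-1 ^+ 2 <= 3 * (4 / 9) ^+ 2.
  apply: ler_pM => //; rewrite ?sqr_ge0 ?(ltW q0)//.
  by apply: lerXn2r; rewrite ?nnegrE ?(ltW Vi0)//; lra.
have -> : (x + 3) * (12 * V * dl ^- 2) = 3 / 4 * V^-1 * x + 9 / 4 * V^-1.
  by rewrite dE2; field.
have -> : 64 * q * dl ^- 2 = 4 * (q * V^-1 ^+ 2) by rewrite dE2; field.
rewrite [(C1 sa + _) * x]mulrDl; move: h1 h2 hC2; set A := C1 sa * x.
set B := _ * D ^- 2 * x; lra.
Qed.

Theorem theorem1 (R : realType) (d : measure_display) (Omega : measurableType d)
  (P : probability Omega R) (K : nat) (k0 : 'I_K) (hk0 : nat_of_ord k0 = 0%N)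
  (mu : 'I_K -> R) (sa : R)
  (Y : 'I_K -> nat -> Omega -> R) (W : nat -> 'I_K -> nat -> Omega -> R)
  (hopt : forall k, mu k <= mu k0)
  (hsa : 3 / 2 < sa)
  (hYmeas : forall k j, measurable_fun setT (Y k j))
  (hWmeas : forall t k i, measurable_fun setT (W t k i))
  (hYlaw : forall k j, has_normal_law P (Y k j) (mu k) 1)
  (hWlaw : forall t k i, has_normal_law P (W t k i) 0 1)
  (hindep : mutually_independent P
     (fun z : ('I_K * nat) + (nat * 'I_K * nat) =>
        match z with
        | inl (k, j) => Y k j
        | inr (t, k, i) => W t k i
        end))
  (T : nat) (hT : (2 <= T)%N) :
  (reboot_regret P k0 mu sa Y W T <=
   (\sum_(k < K | k != k0)
      (mu k0 - mu k) * (6 + (C1 sa + C2 sa * (mu k0 - mu k) ^- 2) * ln T%:R))%:E)%E.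
Proof.
rewrite /reboot_regret (bigD1 k0)//= subrr mul0e add0e -sumEFin.
apply: lee_sum => k kk0; set D := mu k0 - mu k.
have : 0 <= D by rewrite subr_ge0.
(* An arm tied with the optimal one contributes 0 to both sides. *)
rewrite le_eqVlt => /predU1P[<-|D0]; first by rewrite mul0e mul0r.
rewrite EFinM; apply: lee_wpmul2l; first by rewrite lee_fin ltW.
(* The first bound on [dl] keeps [mu k + dl] below [mu k0 - dl]; the second ensures [th <= 2/3]. *)
pose dl := Num.min (D / 2) (4 * sa ^+ 2); pose th := dl / (6 * sa ^+ 2).
have sa0 : 0 < sa by lra.
have sa2 : 0 < sa ^+ 2 by rewrite exprn_gt0.
have dl0 : 0 < dl by rewrite /dl lt_min divr_gt0//= mulr_gt0.
have th0 : 0 < th by rewrite divr_gt0// mulr_gt0.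
have th1 : th <= 2 / 3.
  rewrite /th ler_pdivrMr ?mulr_gt0//.
  by rewrite [leRHS](_ : _ = 4 * sa ^+ 2) ?ge_min ?lexx ?orbT//; field.
have hdl : dl = 6 * sa ^+ 2 * th.
  by rewrite /th mulrC divfK// mulf_neq0// gt_eqF.
have gap : mu k + dl <= mu k0 - dl.
  have : dl <= D / 2 by rewrite /dl ge_min lexx.
  rewrite /D; lra.
apply: (@le_trans _ _ (1 + (ln T%:R + 3) / chernoff_rate sa th +
    64 * (Num.sqrt (1 - 2 / sa ^+ 2))^-1 / dl ^+ 2)%:E).
  exact: (expected_counts P K k0 mu sa Y W hsa hYmeas hWmeas hYlaw hWlaw hindep
    dl th th0 th1 hdl k T (ltnW hT) kk0 gap).
rewrite lee_fin /chernoff_rate.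
by apply: (regret_constants sa D _ dl th hsa D0 (ln_nat_ge_half T hT)).
Qed.
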